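(* Let $C_{-1}(x_0,\underline{x})=\frac{1}{\sigma_{m+1}}\frac{x_0-\overline{e_0}\,\underline{x}}{|x|^{m+1}}$, and let $C_{-1}^{+}$, $C_{-1}^{-}$ denote its restrictions to the half-spaces $\mathbb{R}^{m+1}_+$, $\mathbb{R}^{m+1}_-$. The distributional limits $c_{-1}^{\pm}=\lim_{x_0\to 0\pm}C_{-1}(x_0,\cdot)$ on $\mathbb{R}^m$ satisfy $$c_{-1}^+-c_{-1}^-=\delta(\underline{x}),\qquad c_{-1}^++c_{-1}^-=\overline{e_0}\,H(\underline{x}).$$ In this way $\delta$ and $H$ are represented by couples of monogenic functions: $$\delta(\underline{x})\longleftrightarrow\bigl(C_{-1}^+,\,C_{-1}^-\bigr)=\left(\frac{1}{\sigma_{m+1}}\frac{x_0-\overline{e_0}\,\underline{x}}{|x|^{m+1}},\ \frac{1}{\sigma_{m+1}}\frac{x_0-\overline{e_0}\,\underline{x}}{|x|^{m+1}}\right),$$ $$H(\underline{x})\longleftrightarrow\bigl(e_0\,C_{-1}^+,\ \overline{e_0}\,C_{-1}^-\bigr)=\left(\frac{1}{\sigma_{m+1}}\frac{x_0e_0-\underline{x}}{|x|^{m+1}},\ \frac{1}{\sigma_{m+1}}\frac{x_0\overline{e_0}+\underline{x}}{|x|^{m+1}}\right).$$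
   Context: $\mathbb{R}_{0,m+1}$ is the real Clifford algebra generated by $e_0,e_1,\dots,e_m$ with $e_\alpha e_\beta+e_\beta e_\alpha=-2\delta_{\alpha\beta}$; $\overline{e_0}=-e_0$. Points of $\mathbb{R}^{m+1}$ are written $x=x_0e_0+\underline{x}$ with $\underline{x}=\sum_{j=1}^m x_je_j$; $r=|\underline{x}|$, $\underline{\omega}=\underline{x}/r$, $|x|^2=x_0^2+r^2$. $\mathbb{R}^{m+1}_\pm=\{\pm x_0>0\}$, and the boundary $\{x_0=0\}$ is identified with $\mathbb{R}^m$. $\sigma_{n}=\frac{2\pi^{n/2}}{\Gamma(n/2)}$ is the area of the unit sphere in $\mathbb{R}^{n}$. Put $\underline{\partial}=\sum_{j=1}^m e_j\partial_{x_j}$ and $D=\frac12(\partial_{x_0}+\overline{e_0}\,\underline{\partial})$. A continuously differentiable $\mathbb{R}_{0,m+1}$-valued function $F$ on an open set is called (left-)monogenic there if $DF=0$. $\delta$ is the Dirac distribution on $\mathbb{R}^m$ and $H=-\frac{2}{\sigma_{m+1}}\,\mathrm{Pv}\,\frac{\underline{\omega}}{r^m}$ is the (Clifford-vector valued) Hilbert kernel, $\mathrm{Pv}$ being the Cauchy principal value. Notation: for a distribution $T$ on $\mathbb{R}^m$, $T\longleftrightarrow(F,G)$ means that $T(\underline{x})=\lim_{x_0\to0+}F(x_0,\underline{x})-\lim_{x_0\to0-}G(x_0,\underline{x})$, the limits being taken in distributional sense and the functions $F$ and $G$ being monogenic in the respective half-spaces $\mathbb{R}^{m+1}_+$ and 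$\mathbb{R}^{m+1}_-$.
   Formalization: The couple for H is shown to be right-monogenic (FD=0) rather than left-monogenic (DF=0), because e_0 C_{-1} is not left-monogenic: D(e_0 C_{-1}) = m \overline{e_0}/σ_{m+1} at x = e_0, for every m ≥ 1. *)

(* Defs.v *)
From HB Require Import structures.
From mathcomp Require Import all_boot all_order all_algebra.
From mathcomp Require Import ring.
From mathcomp Require Import all_classical all_reals all_analysis.

Set Implicit Arguments.
Unset Strict Implicit.
Unset Printing Implicit Defensive.

Import Order.TTheory GRing.Theory Num.Theory.
Import numFieldNormedType.Exports.

Local Open Scope classical_set_scope.
Local Open Scope ring_scope.

(** The real Clifford algebra R_{0,n}, on the basis e_A, A a subset of
    {0, ..., n-1}: e_A e_B = (-1)^N e_(A + B), where A + B is the symmetric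
    difference and N the number of pairs (i, j) in A x B with j <= i.  The pairs
    with j < i count the transpositions needed to sort the product, those with
    j = i the relations e_i ^ 2 = -1. *)

Definition clifford (R : comNzRingType) (n : nat) := {ffun {set 'I_n} -> R^o}.

HB.instance Definition _ (R : comNzRingType) (n : nat) :=
  GRing.Lmodule.on (clifford R n).

Section CliffordAlgebra.
Variables (R : comNzRingType) (n : nat).
Implicit Types (A B K : {set 'I_n}) (a b c : clifford R n).

Definition cl_coef A a : R := (a : {ffun {set 'I_n} -> R^o}) A.

Definition cl_basis A : clifford R n := [ffun K => (K == A)%:R].

Definition symdiff A B : {set 'I_n} := ((A :\: B) :|: (B :\: A))%SET.

Definition inversions A B : nat :=
  #|[set p : 'I_n * 'I_n | [&& p.1 \in A, p.2 \in B & (p.2 <= p.1)%N]]%SET|.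

Definition cl_sign A B : R := (-1) ^+ inversions A B.

Definition cl_mul a b : clifford R n :=
  \sum_A \sum_B (cl_sign A B * (cl_coef A a * cl_coef B b)) *:
    cl_basis (symdiff A B).

Lemma cl_coefP a b : (forall A, cl_coef A a = cl_coef A b) -> a = b.
Proof. by move=> h; apply/ffunP. Qed.

Lemma cl_coefD A a b : cl_coef A (a + b) = cl_coef A a + cl_coef A b.
Proof. by rewrite /cl_coef ffunE. Qed.

Lemma cl_coef0 A : cl_coef A 0 = 0.
Proof. by rewrite /cl_coef ffunE. Qed.

Lemma cl_coefZ A (k : R) a : cl_coef A (k *: a) = k * cl_coef A a.
Proof. by rewrite /cl_coef ffunE. Qed.

Lemma cl_coef_sum A (I : Type) (s : seq I) (P : pred I) (F : I -> clifford R n) :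
  cl_coef A (\sum_(i <- s | P i) F i) = \sum_(i <- s | P i) cl_coef A (F i).
Proof. exact: (big_morph _ (cl_coefD A) (cl_coef0 A)). Qed.

Lemma cl_coef_basis A K : cl_coef K (cl_basis A) = (K == A)%:R.
Proof. by rewrite /cl_coef ffunE. Qed.

Lemma in_symdiff i A B : (i \in symdiff A B) = (i \in A) (+) (i \in B).
Proof. by rewrite !inE; case: (i \in A); case: (i \in B). Qed.

Lemma symdiffA : associative symdiff.
Proof. by move=> A B C; apply/setP => i; rewrite !in_symdiff addbA. Qed.

Lemma symdiffK A : involutive (symdiff A).
Proof. by move=> B; apply/setP => i; rewrite !in_symdiff addKb. Qed.

Lemma symdiff0s A : symdiff finset.set0 A = A.
Proof. by apply/setP => i; rewrite in_symdiff inE. Qed.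

Lemma symdiffs0 A : symdiff A finset.set0 = A.
Proof. by apply/setP => i; rewrite in_symdiff inE addbF. Qed.

Lemma cl_signE A B : cl_sign A B =
  \prod_(p : 'I_n * 'I_n | (p.2 <= p.1)%N)
    (if (p.1 \in A) && (p.2 \in B) then -1 else 1).
Proof.
rewrite /cl_sign /inversions -big_mkcondr /= -[LHS]prodr_const.
by apply: eq_bigl => p; rewrite inE andbA [RHS]andbC.
Qed.

Lemma cl_sign_symdiffl A B K :
  cl_sign (symdiff A B) K = cl_sign A K * cl_sign B K.
Proof.
rewrite !cl_signE -big_split /=; apply: eq_bigr => p _; rewrite in_symdiff.
by do 3 case: (_ \in _); rewrite /= ?mulrNN ?mulr1 ?mul1r.
Qed.

Lemma cl_sign_symdiffr A B K :
  cl_sign K (symdiff A B) = cl_sign K A * cl_sign K B.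
Proof.
rewrite !cl_signE -big_split /=; apply: eq_bigr => p _; rewrite in_symdiff.
by do 3 case: (_ \in _); rewrite /= ?mulrNN ?mulr1 ?mul1r.
Qed.

Lemma cl_sign_sqr A B : cl_sign A B * cl_sign A B = 1.
Proof. by rewrite /cl_sign -exprD addnn -mul2n exprM sqrrN expr1n expr1n. Qed.

Lemma cl_coef_mul K a b : cl_coef K (cl_mul a b) =
  \sum_A cl_sign A (symdiff A K) * (cl_coef A a * cl_coef (symdiff A K) b).
Proof.
rewrite /cl_mul cl_coef_sum; apply: eq_bigr => A _.
rewrite cl_coef_sum (bigD1 (symdiff A K)) //= cl_coefZ cl_coef_basis symdiffK.
rewrite eqxx mulr1 big1 ?addr0// => B neB.
rewrite cl_coefZ cl_coef_basis (_ : K == _ = false) ?mulr0//.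
by apply: contraNF neB => /eqP ->; rewrite symdiffK.
Qed.

Lemma cl_mulA : associative cl_mul.
Proof.
move=> a b c; apply: cl_coefP => K; rewrite !cl_coef_mul.
under eq_bigr => A _ do rewrite cl_coef_mul 2!mulr_sumr
  (reindex_inj (inv_inj (symdiffK A))) /=.
under [RHS]eq_bigr => A _ do rewrite cl_coef_mul mulr_suml mulr_sumr.
rewrite exchange_big /= [RHS]exchange_big /= exchange_big /=.
apply: eq_bigr => A _; apply: eq_bigr => B _.
have -> : symdiff (symdiff A B) (symdiff A K) = symdiff B K.
  by apply/setP => i; rewrite !in_symdiff; do 3 case: (_ \in _).
rewrite !cl_sign_symdiffl !cl_sign_symdiffr.
set aa := cl_coef _ a; set bb := cl_coef _ b; set cc := cl_coef _ c.
transitivity (cl_sign A K * cl_sign A K * (cl_sign A A * cl_sign A B *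
  cl_sign B B * cl_sign B K * (aa * (bb * cc)))); first by ring.
by rewrite cl_sign_sqr; ring.
Qed.

Lemma cl_sign0l A : cl_sign finset.set0 A = 1.
Proof. by rewrite cl_signE big1// => p _; rewrite inE. Qed.

Lemma cl_sign0r A : cl_sign A finset.set0 = 1.
Proof. by rewrite cl_signE big1// => p _; rewrite inE andbF. Qed.

Lemma cl_mul1l : left_id (cl_basis finset.set0) cl_mul.
Proof.
move=> a; apply: cl_coefP => K; rewrite cl_coef_mul (bigD1 finset.set0) //=.
rewrite big1 ?addr0 => [|A /negPf nA0]; rewrite cl_coef_basis.
  by rewrite eqxx symdiff0s cl_sign0l !mul1r.
by rewrite nA0 mul0r mulr0.
Qed.

Lemma cl_mul1r : right_id (cl_basis finset.set0) cl_mul.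
Proof.
move=> a; apply: cl_coefP => K; rewrite cl_coef_mul (bigD1 K) //=.
have symdiffss : symdiff K K = finset.set0.
  by apply/setP => i; rewrite in_symdiff inE addbb.
rewrite big1 ?addr0 => [|A nAK]; rewrite cl_coef_basis.
  by rewrite symdiffss cl_sign0r eqxx mulr1 mul1r.
rewrite (_ : _ == _ = false) ?mulr0 ?mulr0//.
apply: contraNF nAK => /eqP h.
by rewrite -(symdiffK A K) h symdiffs0.
Qed.

Lemma cl_mulDl : left_distributive cl_mul +%R.
Proof.
move=> a b c; apply: cl_coefP => K; rewrite cl_coefD !cl_coef_mul -big_split /=.
by apply: eq_bigr => A _; rewrite cl_coefD; ring.
Qed.

Lemma cl_mulDr : right_distributive cl_mul +%R.
Proof.
move=> a b c; apply: cl_coefP => K; rewrite cl_coefD !cl_coef_mul -big_split /=.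
by apply: eq_bigr => A _; rewrite cl_coefD; ring.
Qed.

Lemma cl_one_neq0 : cl_basis finset.set0 != 0.
Proof.
apply/eqP => /(congr1 (cl_coef finset.set0)).
by rewrite cl_coef_basis cl_coef0 eqxx => /eqP; rewrite oner_eq0.
Qed.

HB.instance Definition _ := GRing.Zmodule_isNzRing.Build (clifford R n)
  cl_mulA cl_mul1l cl_mul1r cl_mulDl cl_mulDr cl_one_neq0.

Lemma cl_coefM K a b : cl_coef K (a * b) =
  \sum_A cl_sign A (symdiff A K) * (cl_coef A a * cl_coef (symdiff A K) b).
Proof. exact: cl_coef_mul. Qed.

Lemma cl_scaleAl (k : R) a b : k *: (a * b) = k *: a * b.
Proof.
apply: cl_coefP => K; rewrite cl_coefZ !cl_coefM mulr_sumr.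
by apply: eq_bigr => A _; rewrite cl_coefZ; ring.
Qed.

HB.instance Definition _ :=
  GRing.Lmodule_isLalgebra.Build R (clifford R n) cl_scaleAl.

Lemma cl_scaleAr (k : R) a b : k *: (a * b) = a * (k *: b).
Proof.
apply: cl_coefP => K; rewrite cl_coefZ !cl_coefM mulr_sumr.
by apply: eq_bigr => A _; rewrite cl_coefZ; ring.
Qed.

HB.instance Definition _ :=
  GRing.Lalgebra_isAlgebra.Build R (clifford R n) cl_scaleAr.

Definition cl_gen (i : 'I_n) : clifford R n := cl_basis [set i]%SET.

Lemma cl_basisM A B :
  cl_basis A * cl_basis B = cl_sign A B *: cl_basis (symdiff A B).
Proof.
apply: cl_coefP => K; rewrite cl_coefM cl_coefZ (bigD1 A) //= big1 ?addr0.
  rewrite !cl_coef_basis eqxx mul1r -(inj_eq (inv_inj (symdiffK A)) K) symdiffK.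
  by case: eqP => [->|]; rewrite ?mulr0.
by move=> C /negPf nCA; rewrite cl_coef_basis nCA mul0r mulr0.
Qed.

Lemma cl_gen_anticomm i j :
  cl_gen i * cl_gen j + cl_gen j * cl_gen i = - ((i == j)%:R *+ 2).
Proof.
have sgn k l : cl_sign [set k]%SET [set l]%SET = (-1) ^+ (l <= k)%N.
  rewrite cl_signE; have [lk|kl] := leqP l k.
    rewrite (bigD1 (k, l)) //= !inE !eqxx /= big1 ?mulr1// => -[p q] /andP[_].
    by rewrite xpair_eqE !inE => /negPf ->.
  rewrite big1// => -[p q] /=; rewrite !inE.
  by case: eqP => //= ->; case: eqP => //= ->; rewrite leqNgt kl.
rewrite /cl_gen !cl_basisM !sgn.
have -> : symdiff [set j]%SET [set i]%SET = symdiff [set i]%SET [set j]%SET.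
  by apply/setP => k; rewrite !in_symdiff addbC.
have [<-{j}|nij] := eqVneq i j.
  rewrite leqnn expr1 (_ : symdiff _ _ = finset.set0); last first.
    by apply/setP => k; rewrite in_symdiff addbb finset.in_set0.
  by rewrite scaleN1r -opprD mulr2n.
rewrite mul0rn oppr0 -scalerDl.
move: nij; rewrite -val_eqE /= neq_ltn => /orP[] lt_ij.
  by rewrite (ltnW lt_ij) leqNgt lt_ij /= expr0 expr1 subrr scale0r.
by rewrite (ltnW lt_ij) leqNgt lt_ij /= expr0 expr1 addNr scale0r.
Qed.

End CliffordAlgebra.

(** Lebesgue measure on R^n, as the n-fold product of the Lebesgue measure of
    R; integrals over 'rV_n are taken through \row_i tnth t i. *)

Section LebesgueTuple.
Variable R : realType.
Local Notation T := (measurableTypeR R).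

Section Cons.
Variable n : nat.
Variable mu : {sigma_finite_measure set (n.-tuple T) -> \bar R}.

Definition tuple_cons (p : T * n.-tuple T) : n.+1.-tuple T :=
  [the n.+1.-tuple T of p.1 :: p.2].

Lemma measurable_tuple_cons : measurable_fun [set: T * n.-tuple T] tuple_cons.
Proof. exact: measurable_cons. Qed.

Definition cons_measure : set (n.+1.-tuple T) -> \bar R :=
  pushforward (@lebesgue_measure R \x mu)%E tuple_cons.

HB.instance Definition _ := Measure.copy cons_measure
  (measure_function_pushforward__canonical__measure_function_Measure
    (@lebesgue_measure R \x mu)%E measurable_tuple_cons).

Lemma cons_measure_sigma_finite : sigma_finite setT cons_measure.
Proof.
(* The canonical sigma-finite structure on \x only covers subprobabilities. *)
have [F TF mF] : sigma_finite setT (@lebesgue_measure R \x mu)%E.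
  by case: (lebesgue_integral_fubini.measure_function_Measure_isSigmaFinite__to__measure_function_isSigmaFinite
    (@lebesgue_measure R) mu).
pose uncons (t : n.+1.-tuple T) : T * n.-tuple T := (thead t, [tuple of behead t]).
have consK : cancel tuple_cons uncons.
  by case=> x t; congr pair; apply/val_inj.
exists (fun i => uncons @^-1` F i).
  by rewrite -preimage_bigcup -TF preimage_setT.
move=> i; have [mFi Fi] := mF i; split.
  rewrite -[X in measurable X]setTI.
  apply: (_ : measurable_fun setT uncons) => //.
  apply/measurable_fun_pair => /=.
    exact: (measurable_tnth ord0).
  exact: measurable_behead.
by rewrite /cons_measure /pushforward -comp_preimage (_ : _ \o _ = id) //; apply/funext.
Qed.

HB.instance Definition _ := Measure_isSigmaFinite.Build _ _ _ cons_measure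
  cons_measure_sigma_finite.

End Cons.

Fixpoint lebesgue_tuple (n : nat) :
    {sigma_finite_measure set (n.-tuple T) -> \bar R} :=
  match n return {sigma_finite_measure set (n.-tuple T) -> \bar R} with
  | 0%N => \d_([tuple] : 0.-tuple T)
  | n'.+1 => cons_measure (lebesgue_tuple n')
  end.

Definition integral_rV (n : nat) (D : set 'rV[R]_n) (f : 'rV[R]_n -> R) : R :=
  let row_of (t : n.-tuple T) : 'rV[R]_n := \row_i tnth t i in
  \int[lebesgue_tuple n]_(t in row_of @^-1` D) f (row_of t).

End LebesgueTuple.

Section SpecialConstants.
Variable R : realType.

Definition Gamma (a : R) : R :=
  \int[lebesgue_measure]_(t in `]0, +oo[) (t `^ (a - 1) * expR (- t)).

(* Area of the unit sphere of R^n. *)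
Definition sphere_area (n : nat) : R :=
  2 * pi `^ (n%:R / 2) / Gamma (n%:R / 2).

End SpecialConstants.

Section HalfSpaces.
Variables (R : realType) (m : nat).

(* The norm of 'rV[R]_m in the library is the sup norm, whence [enorm]. *)
Definition enorm (x : 'rV[R]_m) : R := Num.sqrt (\sum_j x ord0 j ^+ 2).

Local Notation Cl := (clifford R m.+1).
(* A point (x_0, x) of R^{m+1}. *)
Local Notation pt := (R * 'rV[R]_m)%type.

Definition e0 : Cl := cl_gen R ord0.
(* The Clifford conjugate of e_0. *)
Definition e0bar : Cl := - e0.
Definition ej (j : 'I_m) : Cl := cl_gen R (lift ord0 j).
Definition cl_vec (x : 'rV[R]_m) : Cl := \sum_j x ord0 j *: ej j.

Definition upper_half : set pt := [set x | 0 < x.1].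
Definition lower_half : set pt := [set x | x.1 < 0].

Definition dir0 : pt := (1, 0).
Definition dirj (j : 'I_m) : pt := (0, delta_mx ord0 j).

Definition cl_partial (v : pt) (F : pt -> Cl) (x : pt) : Cl :=
  [ffun A => 'D_v (cl_coef A \o F) x].

(* D F for D = 1/2 (d_{x_0} + \overline{e_0} \sum_j e_j d_{x_j}). *)
Definition cl_D (F : pt -> Cl) (x : pt) : Cl :=
  2^-1 *: (cl_partial dir0 F x + e0bar * \sum_j ej j * cl_partial (dirj j) F x).

(* F D, the same operator with its coefficients acting from the right. *)
Definition cl_Dr (F : pt -> Cl) (x : pt) : Cl :=
  2^-1 *: (cl_partial dir0 F x + \sum_j cl_partial (dirj j) F x * (e0bar * ej j)).

Definition C1_on (U : set pt) (F : pt -> Cl) : Prop :=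
  forall A x, U x ->
    differentiable (cl_coef A \o F) x /\
    forall v, {for x, continuous ('D_v (cl_coef A \o F))}.

Definition left_monogenic (U : set pt) (F : pt -> Cl) : Prop :=
  C1_on U F /\ forall x, U x -> cl_D F x = 0.

Definition right_monogenic (U : set pt) (F : pt -> Cl) : Prop :=
  C1_on U F /\ forall x, U x -> cl_Dr F x = 0.

(** Clifford-valued distributions on R^m, as functionals on real test functions;
    only their values on test functions are meaningful. *)

Definition iter_partial (s : seq 'I_m) (f : 'rV[R]_m -> R) : 'rV[R]_m -> R :=
  foldr (fun j g => 'D_(delta_mx ord0 j) g) f s.

Definition smooth (f : 'rV[R]_m -> R) : Prop :=
  forall s x, differentiable (iter_partial s f) x.

Definition tsupport (f : 'rV[R]_m -> R) : set 'rV[R]_m :=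
  closure [set x | f x != 0].

Definition test_function (f : 'rV[R]_m -> R) : Prop :=
  smooth f /\ compact (tsupport f).

Definition functional := ('rV[R]_m -> R) -> Cl.

(* [B] bounds all the derivatives of order at most [N] of the test function, so
   that the estimate is the usual one in terms of their suprema. *)
Definition is_distribution (T : functional) : Prop :=
  (forall (a : R) f g, test_function f -> test_function g ->
     T (fun x => a * f x + g x) = a *: T f + T g) /\
  (forall K : set 'rV[R]_m, compact K ->
     exists (c : R) (N : nat), forall f, test_function f -> tsupport f `<=` K ->
       forall B : R,
         (forall s x, (size s <= N)%N -> `|iter_partial s f x| <= B) ->
         forall A, `|cl_coef A (T f)| <= c * B).

Definition eq_distribution (T S : functional) : Prop :=
  forall f, test_function f -> T f = S f.

Definition cl_integral (D : set 'rV[R]_m) (g : 'rV[R]_m -> Cl) : Cl :=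
  [ffun A => integral_rV D (cl_coef A \o g)].

(* lim_{x_0 -> l} F(x_0, .) = T in distributional sense. *)
Definition dist_lim (F : pt -> Cl) (l : set_system R) (T : functional) : Prop :=
  is_distribution T /\
  forall f, test_function f -> forall A,
    cl_coef A (cl_integral setT (fun x => f x *: F (x0, x))) @[x0 --> l]
      --> cl_coef A (T f).

(* T <--> (F, G); only the values of F on the upper half-space and those of G on
   the lower one matter, so that a function stands here for its restriction to a
   half-space.

   [monogenic] is [left_monogenic] or [right_monogenic].  Both are needed: the
   kernel C = [cauchy_kernel] is two-sided monogenic, hence its left multiples
   e_0 C and \overline{e_0} C are right-monogenic, but they are not left-monogenic
   (for instance D(e_0 C) = (m / \sigma_{m+1}) \overline{e_0} at x = e_0). *)
Definition represented_by (monogenic : set pt -> (pt -> Cl) -> Prop)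
    (T : functional) (F G : pt -> Cl) : Prop :=
  [/\ is_distribution T, monogenic upper_half F, monogenic lower_half G &
   exists Tp Tm : functional,
     [/\ dist_lim F 0^'+ Tp, dist_lim G 0^'- Tm &
         eq_distribution T (fun f => Tp f - Tm f)]].

Definition dirac_delta : functional := fun f => (f 0)%:A.

Definition Pv_truncated (k : 'rV[R]_m -> Cl) (f : 'rV[R]_m -> R) (eps : R) : Cl :=
  cl_integral [set x | eps < enorm x] (fun x => f x *: k x).

Definition Pv_exists (k : 'rV[R]_m -> Cl) : Prop :=
  forall f, test_function f -> forall A,
    cvg (cl_coef A (Pv_truncated k f eps) @[eps --> 0^'+]).

Definition Pv (k : 'rV[R]_m -> Cl) : functional := fun f =>
  [ffun A => lim (cl_coef A (Pv_truncated k f eps) @[eps --> 0^'+])].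

(* \underline{omega} / r^m *)
Definition hilbert_density (x : 'rV[R]_m) : Cl :=
  (enorm x ^+ m)^-1 *: ((enorm x)^-1 *: cl_vec x).

Definition hilbert : functional := fun f =>
  - (2 / sphere_area R m.+1) *: Pv hilbert_density f.

Definition pnorm (x : pt) : R := Num.sqrt (x.1 ^+ 2 + enorm x.2 ^+ 2).

Definition cauchy_kernel (x : pt) : Cl :=
  (sphere_area R m.+1)^-1 *:
    ((pnorm x ^+ m.+1)^-1 *: (x.1%:A - e0bar * cl_vec x.2)).

End HalfSpaces.

(* Main.v *)
Require Import Defs.
From mathcomp Require Import all_boot all_order all_algebra.
From mathcomp Require Import ring lra.
From mathcomp Require Import all_classical all_reals all_analysis
  measurable_realfun.
Import Order.TTheory GRing.Theory Num.Theory.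
Import numFieldNormedType.Exports.
Set Implicit Arguments.
Unset Strict Implicit.
Unset Printing Implicit Defensive.
Local Open Scope classical_set_scope.
Local Open Scope ring_scope.

(** With e_j' = \overline{e_0} e_j the kernel is the classical Cauchy kernel
    (x_0 - x') / |x| ^ (m+1) of the operator d_0 + sum_j e_j' d_j, and
    monogenicity follows from (x_0 - x') (x_0 + x') = |x| ^ 2.  As x_0 -> 0, its
    scalar part is half a Poisson kernel: inserting
    |x| ^ (-2a) = Gamma(a)^-1 \int t ^ (a-1) exp(- t |x| ^ 2) dt and integrating
    the Gaussian shows that its total mass is sign(x_0) / 2, so it tends to
    sign(x_0) delta / 2.  Its vector part is odd in x, so that only the odd part
    of the test function matters; since the odd part is O(|x|), dominated
    convergence identifies the limit, from either side, with the principal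
    value.  The dominating function |x| ^ (1-m) is locally integrable because it
    is bounded by an integral over x_0 of Poisson kernels, whose masses are
    constant. *)

(** * The Gamma function and Gaussian integrals *)

(** The constant [sphere_area] is built from [Gamma], so the mass of the Poisson kernel has to come
    out in terms of that same integral. Gaussians factorise over the coordinates and so stand in for
    polar coordinates; integrating one out over R^n lowers the exponent of t by n/2, which leaves
    Gamma(1/2) for every n, and this value comes from the arctangent integral. The identities are
    products in the extended reals: a finite positive right-hand side forces both Gamma((n+1)/2) and
    the Poisson integral to be finite and nonzero, without any recursion formula for Gamma.

    The other obstacle is that the vector part of the limit kernel has size |x|^(-m), which is not
    integrable at 0. The absolutely convergent integral [odd_pairing] is the common target of the
    half-space limits and of the truncations defining the principal value. One convergence lemma
    serves both, since both kernels are even, dominated by |x|^(-m-1) and pointwise convergent to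
    it. One-sided limits are tested along sequences, as dominated convergence requires. *)

Lemma ge0_integral_lebesgue_scale (R : realType) (c : R) (f : R -> \bar R) :
  0 < c -> measurable_fun setT f -> (forall x, 0 <= f x)%E ->
  (\int[lebesgue_measure]_x f (c * x)%R =
   c^-1%:E * \int[lebesgue_measure]_x f x)%E.
Proof.
move=> c0 mf f0.
have mc : measurable_fun setT
    ( *%R c : measurableTypeR R -> measurableTypeR R).
  exact: mulrl_measurable.
pose pf : {measure set (measurableTypeR R) -> \bar R} :=
  measure_function_pushforward__canonical__measure_function_Measure
    lebesgue_measure mc.
(* The image of Lebesgue measure under multiplication by [c], rescaled by [c], gives []a, b]] the
   mass b - a; uniqueness identifies it with Lebesgue measure. *)
pose nu : {measure set (measurableTypeR R) -> \bar R} :=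
  mscale (NngNum (ltW c0)) pf.
have nuE (A : set (measurableTypeR R)) : measurable A ->
    lebesgue_measure A = nu A.
  move=> mA; apply: lebesgue_measure_unique mA => _ [[a b]] _ <-.
  rewrite [RHS](_ : _ = c%:E * lebesgue_measure
    ( *%R c @^-1` `]a, b] : set (measurableTypeR R)))%E //.
  have -> : *%R c @^-1` `]a, b] = `]a / c, b / c]%classic :> set R.
    apply/seteqP; split=> x /=;
    by rewrite !in_itv /= ltr_pdivrMr // ler_pdivlMr // mulrC.
  rewrite !lebesgue_measure_itv /= !lte_fin ltr_pM2r ?invr_gt0//.
  case: ifP => _; last by rewrite mule0.
  by rewrite -!EFinB -EFinM -mulrBl mulrCA divff ?mulr1// gt_eqF.
rewrite [in RHS](eq_measure_integral nu); last by move=> A mA _; exact: nuE.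
rewrite ge0_integral_mscale//= ge0_integral_pushforward//.
rewrite muleA -EFinM mulVf ?gt_eqF// mul1e.
by rewrite preimage_setT.
Qed.

Lemma ge0_integral_lebesgue_opp (R : realType) (f : R -> \bar R) :
  measurable_fun setT f -> (forall x, 0 <= f x)%E ->
  (\int[lebesgue_measure]_x f (- x)%R = \int[lebesgue_measure]_x f x)%E.
Proof.
move=> mf f0.
rewrite [RHS](eq_measure_integral
  (pushforward lebesgue_measure (-%R : _ -> measurableTypeR R))).
  by rewrite ge0_integral_pushforward//.
by move=> A mA _; exact/esym/lebesgue_measureN.
Qed.

Lemma integral_gaussT (R : realType) (t : R) : 0 < t ->
  (\int[lebesgue_measure]_x (expR (- (t * x ^+ 2)))%:E =
   (Num.sqrt (pi / t))%:E)%E.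
Proof.
move=> t0.
have := @ge0_integral_lebesgue_scale R (Num.sqrt t) (fun x => (gauss_fun x)%:E).
rewrite sqrtr_gt0 t0 integralT_gauss => /(_ isT) H.
rewrite sqrtrM ?pi_ge0// mulrC sqrtrV ?ltW// EFinM -H.
- by apply: eq_integral => x _; rewrite /gauss_fun exprMn sqr_sqrtr // ltW.
- apply/measurable_EFinP; exact: measurable_gauss_fun.
- by move=> x; rewrite lee_fin gauss_fun_ge0.
Qed.

Lemma integralT_oneDsqrV (R : realType) :
  (\int[lebesgue_measure]_x ((1 + x ^+ 2)^-1)%:E = (pi : R)%:E)%E.
Proof.
have cf : continuous (fun x : R => (1 + x ^+ 2)^-1).
  move=> x; apply: cvgV; first by rewrite gt_eqF// ltr_pwDl// sqr_ge0.
  by apply: cvgD; [exact: cvg_cst|exact: exprn_continuous].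
rewrite (ge0_symfun_integralT _ cf) /=; last 2 first.
- by move=> x; rewrite invr_ge0 addr_ge0// sqr_ge0.
- by move=> x /=; rewrite sqrrN.
rewrite -set_itvcy (@ge0_continuous_FTC2y _ _ (@atan R) 0 (pi / 2)).
- by rewrite atan0 sube0 -EFinM mulrC divfK.
- by move=> x _; rewrite invr_ge0 addr_ge0// sqr_ge0.
- by apply: continuous_subspaceT => x; exact: cf.
- exact: cvgy_atan.
- by move=> x _; exact: derivable_atan.
- exact/cvg_at_right_filter/continuous_atan.
- by move=> x _; exact: derive1_atan.
Qed.

Lemma integral0y_expRN (R : realType) :
  (\int[lebesgue_measure]_(t in `]0%R, +oo[) (expR (- t))%:E = (1 : R)%:E)%E.
Proof.
have mE : measurable_fun (`]0, +oo[%classic : set R) (fun t : R => (expR (-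
  t))%:E).
  apply/measurable_EFinP/measurable_funTS.
  by apply: measurableT_comp => //; exact: oppr_measurable.
rewrite integral_itv_obnd_cbnd//.
have := @integral_exponential_pdf R 1 ltr01.
rewrite /exponential_pdf => H; rewrite -H.
rewrite [LHS]integral_mkcond; apply: eq_integral => t _.
by rewrite !patchE; case: ifP => // _; rewrite mul1r mulN1r.
Qed.

(* [Gamma] is [fine] of this integral, hence the junk value [0] at [+oo]. *)
Definition Gamma_ereal (R : realType) (a : R) : \bar R :=
  (\int[lebesgue_measure]_(t in `]0%R, +oo[) (t `^ (a - 1) * expR (- t))%:E)%E.

Lemma Gamma_ereal_ge0 (R : realType) (a : R) : (0 <= Gamma_ereal a)%E.
Proof.
by apply: integral_ge0 => t _; rewrite lee_fin mulr_ge0 ?powR_ge0 ?expR_ge0.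
Qed.

Lemma measurable_fun_Gamma_kernel (R : realType) (a s : R) D :
  measurable_fun D (fun t : R => (t `^ (a - 1) * expR (- (t * s)))%:E).
Proof.
apply/measurable_EFinP/measurable_funTS/measurable_funM.
  exact: measurable_powR.
apply: measurableT_comp => //.
by apply: measurable_funN; exact: mulrr_measurable.
Qed.

(** Substitution of t s for t. Being an identity in the extended reals, it also covers exponents for
    which the integral diverges. *)
Lemma integral_Gamma_scale (R : realType) (a s : R) : 0 < s ->
  (\int[lebesgue_measure]_(t in `]0%R, +oo[)
     (t `^ (a - 1) * expR (- (t * s)))%:E =
   (s `^ (- a))%:E * Gamma_ereal a)%E.
Proof.
move=> s0; rewrite /Gamma_ereal.
have sE : s * s `^ (- a) * s `^ (a - 1) = 1.
  rewrite -[X in X * _ * _](powRr1 (ltW s0)).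
  rewrite -powRD; last by rewrite (gt_eqF s0) implybT.
  rewrite -powRD; last by rewrite (gt_eqF s0) implybT.
  by rewrite (_ : 1 + - a + (a - 1) = 0) ?powRr0//; ring.
rewrite [in RHS]integral_mkcond.
set g := (_ \_ _)%R.
have mg : measurable_fun setT g.
  apply/(measurable_restrictT _ _).1 => //.
  have := @measurable_fun_Gamma_kernel R a 1 `]0, +oo[%classic.
  by apply: eq_measurable_fun => t _; rewrite mulr1.
have g0 x : (0 <= g x)%E.
  by apply: erestrict_ge0 => t _; rewrite lee_fin mulr_ge0 ?powR_ge0 ?expR_ge0.
have := ge0_integral_lebesgue_scale s0 mg g0 => /(congr1 (fun z => (s * s `^
  (-a))%:E * z))%E.
rewrite muleA -EFinM mulrAC divff ?gt_eqF// mul1r => <-.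
rewrite [LHS]integral_mkcond -ge0_integralZl//; last 2 first.
  apply: (measurableT_comp mg); exact: mulrl_measurable.
  by rewrite lee_fin mulr_ge0 ?powR_ge0 ?ltW.
apply: eq_integral => x _; rewrite /g !patchE.
have -> : (s * x \in `]0, +oo[%classic) = (x \in `]0, +oo[%classic).
  by rewrite !mem_setE !in_itv /= !andbT pmulr_rgt0.
case: ifPn => [|_]; last by rewrite mule0.
rewrite mem_setE in_itv /= andbT => x0.
rewrite -EFinM; congr EFin; rewrite powRM ?ltW// [x * s]mulrC.
by rewrite mulrA mulrA sE mul1r.
Qed.

Lemma Gamma_ereal1 (R : realType) : Gamma_ereal (1 : R) = 1%E.
Proof.
rewrite /Gamma_ereal -integral0y_expRN; apply: eq_integral => t _.
by rewrite subrr powRr0 mul1r.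
Qed.

(* Tonelli on [t `^ (a - 1) * expR (- t * (y ^ 2 + |x| ^ 2))], for an abstract
   positive function [y ^ 2 + |x| ^ 2]. *)
Lemma Gamma_ereal_tonelli d (T : measurableType d) (R : realType)
    (mu : {sigma_finite_measure set T -> \bar R}) (a : R) (N : T -> R) :
  measurable_fun setT N -> (forall x, 0 < N x) ->
  (Gamma_ereal a * \int[mu]_x (N x `^ (- a))%:E =
   \int[lebesgue_measure]_(t in `]0%R, +oo[)
     ((t `^ (a - 1))%:E * \int[mu]_x (expR (- (t * N x)))%:E))%E.
Proof.
move=> mN N0.
pose F (z : T * measurableTypeR R) : \bar R :=
  (\1_(`]0, +oo[%classic : set R) z.2 * (z.2 `^ (a - 1) * expR (- (z.2 * N
    z.1))))%:E.
have mF : measurable_fun setT F.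
  apply/measurable_EFinP; apply: measurable_funM.
    by apply: measurableT_comp => //; exact: measurable_indic.
  apply: measurable_funM.
    by apply: (measurableT_comp (measurable_powR _)).
  apply: measurableT_comp => //; apply: measurable_funN.
  by apply: measurable_funM => //; exact: measurableT_comp.
have F0 z : (0 <= F z)%E.
  by rewrite lee_fin !mulr_ge0 ?powR_ge0 ?expR_ge0.
have := @fubini_tonelli _ _ _ _ _ mu lebesgue_measure F mF F0.
rewrite -ge0_integralZl//; last 3 first.
- apply/measurable_EFinP; exact: (measurableT_comp (measurable_powR _)).
- by move=> x _; rewrite lee_fin powR_ge0.
- exact: Gamma_ereal_ge0.
have -> : (\int[mu]_x \int[lebesgue_measure]_y F (x, y) =
    \int[mu]_x (Gamma_ereal a * (N x `^ (- a))%:E))%E.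
  apply: eq_integral => x _; rewrite muleC -integral_Gamma_scale//.
  rewrite [RHS]integral_mkcond; apply: eq_integral => t _.
  by rewrite patchE /F /= indicE; case: (_ \in _); rewrite ?mul1r ?mul0r.
move=> ->; rewrite [RHS]integral_mkcond; apply: eq_integral => t _.
rewrite patchE /F; case: ifPn => [tp|tn].
  rewrite -ge0_integralZl//.
  - by apply: eq_integral => x _; rewrite indicE tp mul1r.
  - apply/measurable_EFinP; apply: measurableT_comp => //.
    apply: measurable_funN; exact: measurable_funM.
  - by rewrite lee_fin powR_ge0.
by apply: integral0_eq => x _; rewrite /= indicE (negbTE tn) mul0r.
Qed.

(** Tonelli with exponent 1 and N = 1 + x^2. One side is Gamma(1) times the arctangent integral,
    that is pi; on the other the Gaussian turns t^0 into sqrt(pi) t^(-1/2), which gives sqrt(pi)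
    Gamma(1/2). An infinite Gamma(1/2) would contradict the finite value pi. *)
Lemma Gamma_ereal_half (R : realType) :
  Gamma_ereal (2^-1 : R) = (Num.sqrt pi)%:E.
Proof.
have p0 : Num.sqrt pi != 0 :> R by rewrite gt_eqF// sqrtr_gt0 pi_gt0.
have := @Gamma_ereal_tonelli _ (measurableTypeR R) R lebesgue_measure 1
  (fun x => 1 + x ^+ 2).
have -> : (\int[lebesgue_measure]_x ((1 + x ^+ 2) `^ (-1))%:E = (pi : R)%:E)%E.
  rewrite -integralT_oneDsqrV; apply: eq_integral => x _.
  by rewrite powR_inv1// addr_ge0// sqr_ge0.
have mN : measurable_fun setT (fun x : measurableTypeR R => 1 + x ^+ 2).
  by apply: measurable_funD => //; exact: measurable_funX.
have N0 (x : measurableTypeR R) : 0 < 1 + x ^+ 2.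
  by rewrite ltr_pwDl// sqr_ge0.
move=> /(_ mN N0).
rewrite Gamma_ereal1 mul1e.
rewrite (_ : integral _ _ _ = (Num.sqrt pi)%:E * Gamma_ereal 2^-1)%E;
  last first.
  rewrite -ge0_integralZl//; last 2 first.
  - have := @measurable_fun_Gamma_kernel R 2^-1 1 `]0, +oo[%classic.
    by apply: eq_measurable_fun => t _; rewrite mulr1.
  - by move=> t _; rewrite lee_fin mulr_ge0 ?powR_ge0 ?expR_ge0.
  apply: eq_integral => t; rewrite inE /= in_itv /= andbT => t0.
  rewrite subrr powRr0 mul1e.
  under eq_integral do rewrite mulrDr mulr1 opprD expRD EFinM.
  rewrite ge0_integralZl//; last first.
    apply/measurable_EFinP; apply: measurableT_comp => //.
    apply: measurable_funN; apply: measurable_funM => //;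
      exact: measurable_funX.
  rewrite integral_gaussT// -!EFinM; congr EFin.
  rewrite sqrtrM ?pi_ge0// mulrC -mulrA; congr (_ * _); congr (_ * _).
  rewrite sqrtrV ?ltW// -(powR12_sqrt (ltW t0)) -powRN; congr (_ `^ _); lra.
case: (Gamma_ereal 2^-1) => [r||] /=.
- rewrite -EFinM => -[H]; congr EFin; apply: (mulfI p0).
  by rewrite -H -expr2 sqr_sqrtr ?pi_ge0.
- by rewrite muleC gt0_mulye// lte_fin sqrtr_gt0 pi_gt0.
- by rewrite muleC gt0_mulNye// lte_fin sqrtr_gt0 pi_gt0.
Qed.

(** * Gaussian and Poisson integrals in n variables *)

Definition tuple_sqnorm (R : realType) n (t : n.-tuple (measurableTypeR R)) : R
  :=
  \sum_i (tnth t i : R) ^+ 2.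

Lemma tuple_sqnorm_ge0 (R : realType) n (t : n.-tuple (measurableTypeR R)) :
  0 <= tuple_sqnorm t.
Proof. by apply: sumr_ge0 => i _; exact: sqr_ge0. Qed.

Lemma tuple_sqnorm_cons (R : realType) n (x : R)
    (t : n.-tuple (measurableTypeR R)) :
  tuple_sqnorm (tuple_cons (x, t)) = x ^+ 2 + tuple_sqnorm t.
Proof.
rewrite /tuple_sqnorm big_ord_recl tnth0; congr (_ + _).
by apply: eq_bigr => i _; rewrite tnthS.
Qed.

Lemma measurable_tuple_sqnorm (R : realType) n :
  measurable_fun setT (@tuple_sqnorm R n : n.-tuple (measurableTypeR R) -> R).
Proof.
apply: measurable_sum => i; apply: measurable_funX; exact: measurable_tnth.
Qed.

Lemma ge0_integral_lebesgue_tupleS (R : realType) n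
    (f : n.+1.-tuple (measurableTypeR R) -> \bar R) :
  measurable_fun setT f -> (forall x, 0 <= f x)%E ->
  (\int[lebesgue_tuple R n.+1]_t f t =
   \int[lebesgue_measure]_x \int[lebesgue_tuple R n]_t f (tuple_cons (x, t)))%E.
Proof.
move=> mf f0.
rewrite [LHS](@ge0_integral_pushforward _ _ _ _ _ _ (@measurable_tuple_cons R
  n))//.
rewrite preimage_setT fubini_tonelli1//; last by move=> x; exact: f0.
exact: (measurableT_comp mf (@measurable_tuple_cons R n)).
Qed.

Lemma integral_gauss_tuple (R : realType) n (t : R) : 0 < t ->
  (\int[lebesgue_tuple R n]_x (expR (- (t * tuple_sqnorm x)))%:E =
   (Num.sqrt (pi / t) ^+ n)%:E)%E.
Proof.
move=> t0.
have mE k : measurable_fun setT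
    (fun x : k.-tuple (measurableTypeR R) => (expR (- (t * tuple_sqnorm
      x)))%:E).
  apply/measurable_EFinP; apply: measurableT_comp => //.
  by apply: measurable_funN; apply: measurable_funM => //;
    exact: measurable_tuple_sqnorm.
elim: n => [|n IHn].
  rewrite [LHS](integral_dirac ([tuple] : 0.-tuple (measurableTypeR R))
    measurableT (mE 0%N)).
  rewrite diracT mul1e /tuple_sqnorm big_ord0.
  by rewrite mulr0 oppr0 expR0 expr0.
rewrite ge0_integral_lebesgue_tupleS//.
transitivity (\int[lebesgue_measure]_x
    ((Num.sqrt (pi / t) ^+ n)%:E * (expR (- (t * x ^+ 2)))%:E))%E.
  apply: eq_integral => x _.
  under eq_integral do rewrite tuple_sqnorm_cons mulrDr opprD expRD EFinM.
  by rewrite ge0_integralZl//; [rewrite IHn muleC|exact: mE].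
rewrite ge0_integralZl//.
- by rewrite integral_gaussT// -EFinM exprSr.
- apply/measurable_EFinP; apply: measurableT_comp => //.
  apply: measurable_funN; apply: measurable_funM => //; exact: measurable_funX.
Qed.

(** A product is stated because neither factor is known to be finite at this point. *)
Lemma Gamma_ereal_poisson (R : realType) n (y : R) : 0 < y ->
  (Gamma_ereal (n.+1%:R / 2) *
    \int[lebesgue_tuple R n]_x
      ((y ^+ 2 + tuple_sqnorm x) `^ (- (n.+1%:R / 2)))%:E =
   (Num.sqrt pi ^+ n.+1 / y)%:E)%E.
Proof.
move=> y0; rewrite Gamma_ereal_tonelli; last 2 first.
- by apply: measurable_funD => //; exact: measurable_tuple_sqnorm.
- by move=> x; rewrite ltr_pwDl ?exprn_gt0// tuple_sqnorm_ge0.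
transitivity (\int[lebesgue_measure]_(t in `]0%R, +oo[)
    ((Num.sqrt pi ^+ n)%:E * (t `^ (2^-1 - 1) * expR (- (t * y ^+ 2)))%:E))%E.
  apply: eq_integral => t; rewrite inE /= in_itv /= andbT => t0.
  under eq_integral do rewrite mulrDr opprD expRD EFinM.
  rewrite ge0_integralZl//; last first.
    apply/measurable_EFinP; apply: measurableT_comp => //.
    by apply: measurable_funN; apply: measurable_funM => //;
      exact: measurable_tuple_sqnorm.
  rewrite integral_gauss_tuple// -!EFinM; congr EFin.
  rewrite sqrtrM ?pi_ge0// exprMn sqrtrV ?ltW//.
  (* The Gaussian integral over R^n contributes t^(-n/2), and (n+1)/2 - 1 - n/2 = 1/2 - 1. *)
  have -> : t `^ (2^-1 - 1) = t `^ (n.+1%:R / 2 - 1) * (Num.sqrt t)^-1 ^+ n.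
    rewrite -(powR12_sqrt (ltW t0)) -powRN -powR_mulrn ?powR_ge0// -powRrM.
    rewrite -powRD ?(gt_eqF t0) ?implybT//; congr (_ `^ _).
    by rewrite -(natr1 n); lra.
  by rewrite /=; ring.
rewrite ge0_integralZl//; last 2 first.
- exact: measurable_fun_Gamma_kernel.
- by move=> t _; rewrite lee_fin mulr_ge0 ?powR_ge0 ?expR_ge0.
rewrite integral_Gamma_scale ?exprn_gt0// Gamma_ereal_half -!EFinM; congr EFin.
rewrite powRN powR12_sqrt ?sqr_ge0// sqrtr_sqr ger0_norm ?ltW// exprSr; ring.
Qed.

Lemma integral_sqrt_poisson (R : realType) n (y : R) : 0 < y ->
  (\int[lebesgue_tuple R n]_x
     ((Num.sqrt (y ^+ 2 + tuple_sqnorm x) ^+ n.+1)^-1)%:E =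
   (sphere_area R n.+1 / 2 / y)%:E)%E.
Proof.
move=> y0; have := Gamma_ereal_poisson n y0.
under eq_integral do rewrite powRN mulrC powRrM powR12_sqrt
  ?addr_ge0 ?sqr_ge0 ?tuple_sqnorm_ge0// powR_mulrn ?sqrtr_ge0//.
rewrite /sphere_area -[Gamma _]/(fine (Gamma_ereal _)).
rewrite [X in pi `^ X]mulrC powRrM powR12_sqrt ?pi_ge0// powR_mulrn
  ?sqrtr_ge0//.
have p0 : 0 < Num.sqrt (pi : R) ^+ n.+1 / y.
  by rewrite divr_gt0// exprn_gt0// sqrtr_gt0 pi_gt0.
have I0 : (0 <= \int[lebesgue_tuple R n]_x
     ((Num.sqrt (y ^+ 2 + tuple_sqnorm x) ^+ n.+1)^-1)%:E)%E.
  by apply: integral_ge0 => x _; rewrite lee_fin invr_ge0 exprn_ge0// sqrtr_ge0.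
have := Gamma_ereal_ge0 (n.+1%:R / 2 : R).
(* Two nonnegative extended reals with a positive finite product are both finite and nonzero. Only
   after this is [Gamma] known to be the true value of its integral and not the default value 0. *)
move: (Gamma_ereal _) (integral _ _ _) I0 => [g||] [i||] //=.
- rewrite !lee_fin => i0 g0; rewrite -EFinM => -[H].
  have g0' : g != 0 by apply/eqP => g0'; move: H p0; rewrite g0' mul0r => <-;
    rewrite ltxx.
  congr EFin; apply: (mulfI g0'); rewrite H; field.
  by rewrite g0' gt_eqF.
- move=> _; rewrite lee_fin le_eqVlt => /predU1P[<-|g0].
    by rewrite mul0e => -[H]; move: p0; rewrite -H ltxx.
  by rewrite gt0_muley.
- rewrite lee_fin le_eqVlt => /predU1P[<-|i0] _.
    by rewrite mule0 => -[H]; move: p0; rewrite -H ltxx.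
  by rewrite gt0_mulye.
Qed.

(** Half of the constant is a Poisson integral, hence nonnegative; it cannot vanish because its
    product with Gamma((n+1)/2) is a power of sqrt(pi). *)
Lemma sphere_area_gt0 (R : realType) n : 0 < sphere_area R n.+1.
Proof.
have := @integral_sqrt_poisson R n 1 ltr01; rewrite divr1 => H.
have : (0 <= (sphere_area R n.+1 / 2)%:E)%E.
  rewrite -H; apply: integral_ge0 => x _.
  by rewrite lee_fin invr_ge0 exprn_ge0// sqrtr_ge0.
rewrite lee_fin pmulr_lge0// le_eqVlt => /predU1P[s0|//].
have := @Gamma_ereal_poisson R n 1 ltr01.
under eq_integral do rewrite powRN mulrC powRrM powR12_sqrt
  ?addr_ge0 ?sqr_ge0 ?tuple_sqnorm_ge0// powR_mulrn ?sqrtr_ge0//.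
rewrite H -s0 mul0r mule0 divr1 => -[]/eqP.
by rewrite eq_sym expf_eq0 /= gt_eqF// sqrtr_gt0 pi_gt0.
Qed.

(** * Lebesgue integration over row vectors *)

Definition row_of_tuple (R : realType) n (t : n.-tuple (measurableTypeR R)) :
  'rV[R]_n := \row_i tnth t i.

Lemma row_of_tupleE (R : realType) n (t : n.-tuple (measurableTypeR R)) i :
  row_of_tuple t ord0 i = tnth t i.
Proof. by rewrite mxE. Qed.

Lemma enorm_row_of_tuple (R : realType) n (t : n.-tuple (measurableTypeR R)) :
  enorm (row_of_tuple t) = Num.sqrt (tuple_sqnorm t).
Proof.
by rewrite /enorm /tuple_sqnorm; under eq_bigr do rewrite row_of_tupleE.
Qed.

(** The inverse agrees with the power -1 on the closed half-line, both being 0 at 0, and real powers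
    are measurable. *)
Lemma measurable_inv_ge0 d (T : measurableType d) (R : realType) D (f : T -> R)
  :
  (forall x, 0 <= f x) -> measurable_fun D f ->
  measurable_fun D (fun x => (f x)^-1).
Proof.
move=> f0 mf; under eq_fun do rewrite -powR_inv1//.
exact: (measurableT_comp (measurable_powR _)).
Qed.

Lemma measurable_sqrt d (T : measurableType d) (R : realType) D (f : T -> R) :
  measurable_fun D f -> measurable_fun D (fun x => Num.sqrt (f x)).
Proof.
move=> mf; apply: (@measurableT_comp _ _ _ _ _ _ (@Num.sqrt R)) => //.
by apply: continuous_measurable_fun; exact: sqrt_continuous.
Qed.

(* Rounding the coordinates down to [Z / k.+1] turns [f] into a function with
   countably many values, and [f] is the limit of these as [k] grows. *)
Lemma measurable_continuous_row (R : realType) n (f : 'rV[R]_n -> R) :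
  continuous f -> measurable_fun setT (f \o @row_of_tuple R n).
Proof.
move=> cf.
pose q (k : nat) (z : n.-tuple int) : 'rV[R]_n := \row_i ((tnth z i)%:~R /
  k.+1%:R).
pose fl (k : nat) (t : n.-tuple (measurableTypeR R)) : n.-tuple int :=
  [tuple Num.floor (k.+1%:R * tnth t i) | i < n].
apply: (@measurable_fun_cvg _ _ _ _ (fun k t => f (q k (fl k t)))).
- move=> k _ Y mY; rewrite setTI.
  (* [S z] is the grid box on which the rounding [fl k] equals [z]; a preimage under the rounded
     function is then a countable union of such boxes, enumerated through [unpickle]. *)
  pose S (z : n.-tuple int) : set (n.-tuple (measurableTypeR R)) :=
    \bigcap_(i in [set: 'I_n])
      ((@tnth n (measurableTypeR R))^~ i @^-1`
        `[(tnth z i)%:~R / k.+1%:R, ((tnth z i)%:~R + 1) / k.+1%:R[).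
  have SE z t : S z t <-> fl k t = z.
    have E (x : R) (m : int) :
        (x \in `[(m%:~R / k.+1%:R), ((m%:~R + 1) / k.+1%:R)[) <->
        (Num.floor (k.+1%:R * x) = m).
      rewrite in_itv /= ler_pdivrMr ?ltr0n// ltr_pdivlMr ?ltr0n//.
      rewrite [x * _]mulrC; split=> [/andP[h1 h2]|<-].
        by apply: floor_def; rewrite h1 intrD.
      by rewrite floor_le -intrD1 floorD1_gt.
    split=> [Szt|<- i _ /=]; last by apply/E; rewrite tnth_mktuple.
    by apply: eq_from_tnth => i; rewrite tnth_mktuple; apply/E; exact: Szt.
  have mS z : measurable (S z).
    apply: fin_bigcap_measurable => // i _.
    rewrite -[X in measurable X]setTI; exact: measurable_tnth.
  rewrite (_ : _ @^-1` Y = \bigcup_j (if (@unpickle (n.-tuple int) j) is Some z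
    then
      if f (q k z) \in Y then S z else set0 else set0)).
    apply: bigcupT_measurable => j; case: unpickle => [z|//].
    by case: ifP.
  apply/seteqP; split=> [t /= Yt|t [j _]].
    exists (pickle (fl k t)) => //; rewrite pickleK mem_set//.
    exact/SE.
  case: unpickle => [z|[]]; case: ifPn => [/set_mem Yz /SE zE|_ []]//.
  by rewrite /preimage /= zE.
- move=> t _; suff h : q k (fl k t) @[k --> \oo] --> row_of_tuple t.
    exact: (cvg_comp _ _ h (cf _)).
  apply/cvg_ballP => e e0; near=> k; split => // i j.
  rewrite !mxE tnth_mktuple /ball /= ltr_norml.
  have k0 : 0 < k.+1%:R :> R by rewrite ltr0n.
  have h1 := floor_le (k.+1%:R * tnth t j);
    have h2 := floorD1_gt (k.+1%:R * tnth t j).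
  have h3 : e * k.+1%:R > 1.
    rewrite -ltr_pdivrMl// mulr1 invf_plt ?posrE//.
    by near: k; exact: (near_infty_natSinv_lt (PosNum e0)).
  set x := _%:~R in h1 *; rewrite intrD1 in h2.
  have -> : tnth t j = (k.+1%:R * tnth t j) / k.+1%:R by rewrite mulrAC divff
    ?mul1r ?gt_eqF.
  rewrite -mulrBl ltr_pdivrMr// ltr_pdivlMr//; apply/andP; split; lra.
Unshelve. all: by end_near. Qed.

(** * Invariance of Lebesgue measure under x -> -x *)

Definition tuple_opp (R : realType) n (t : n.-tuple (measurableTypeR R)) :
  n.-tuple (measurableTypeR R) := [tuple - tnth t i | i < n].

Lemma measurable_tuple_opp (R : realType) n : measurable_fun setT (@tuple_opp R
  n).
Proof.
apply/measurable_fun_tnthP => i.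
rewrite (_ : _ \o _ = (fun t => - tnth t i)).
  by apply: measurable_funN; exact: measurable_tnth.
by apply/funext => t /=; rewrite tnth_mktuple.
Qed.

Lemma tuple_opp_cons (R : realType) n (x : R) (t : n.-tuple (measurableTypeR
  R)) :
  tuple_opp (tuple_cons (x, t)) = tuple_cons (- x, tuple_opp t).
Proof.
apply: eq_from_tnth => i; rewrite tnth_mktuple.
case: (unliftP ord0 i) => [j ->|->]; last by rewrite !tnth0.
by rewrite !tnthS tnth_mktuple.
Qed.

Lemma row_of_tuple_opp (R : realType) n (t : n.-tuple (measurableTypeR R)) :
  row_of_tuple (tuple_opp t) = - row_of_tuple t.
Proof. by apply/rowP => i; rewrite !mxE tnth_mktuple. Qed.

Lemma ge0_integral_tuple_opp (R : realType) n
    (f : n.-tuple (measurableTypeR R) -> \bar R) :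
  measurable_fun setT f -> (forall x, 0 <= f x)%E ->
  (\int[lebesgue_tuple R n]_t f (tuple_opp t) = \int[lebesgue_tuple R n]_t f
    t)%E.
Proof.
elim: n f => [|n IHn] f mf f0.
  by apply: eq_integral => t _; congr f; apply: eq_from_tnth => -[].
have mc := measurableT_comp mf (@measurable_tuple_cons R n).
rewrite !ge0_integral_lebesgue_tupleS//; last first.
  exact: (measurableT_comp mf (@measurable_tuple_opp R n.+1)).
pose F (x : R) := (\int[lebesgue_tuple R n]_t f (tuple_cons (x, t)))%E.
have mF : measurable_fun setT F.
  apply: (measurable_fun_fubini_tonelli_F (f \o @tuple_cons R n)) => //.
  by move=> z; exact: f0.
have F0 x : (0 <= F x)%E by apply: integral_ge0 => t _.
rewrite -[RHS](ge0_integral_lebesgue_opp mF F0).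
apply: eq_integral => x _; rewrite /F.
under eq_integral do rewrite tuple_opp_cons.
apply: (IHn (fun t => f (tuple_cons (- x, t)))) => //.
apply: (measurableT_comp mc); exact: measurable_fun_pair.
Qed.

Lemma Rintegral_tuple_opp (R : realType) n
    (f : n.-tuple (measurableTypeR R) -> R) : measurable_fun setT f ->
  \int[lebesgue_tuple R n]_t f (tuple_opp t) = \int[lebesgue_tuple R n]_t f t.
Proof.
move=> mf; rewrite /Rintegral; congr fine.
have mE : measurable_fun setT (EFin \o f) by exact/measurable_EFinP.
rewrite [LHS]integralE [RHS]integralE; congr (_ - _)%E.
  rewrite -[RHS](ge0_integral_tuple_opp (measurable_funepos mE))//.
  by apply: eq_integral => t _; rewrite !funeposE.
rewrite -[RHS](ge0_integral_tuple_opp (measurable_funeneg mE))//.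
by apply: eq_integral => t _; rewrite !funenegE.
Qed.

Lemma measurable_enorm_row (R : realType) n :
  measurable_fun setT (fun t : n.-tuple (measurableTypeR R) =>
    enorm (row_of_tuple t)).
Proof.
under eq_fun do rewrite enorm_row_of_tuple.
exact: (measurable_sqrt (@measurable_tuple_sqnorm R n)).
Qed.

(** * Integrable weights on Euclidean balls *)

Definition ball_ind (R : realType) n (rho : R) (x : 'rV[R]_n) : R :=
  (enorm x <= rho)%R%:R.

Lemma ball_ind_ge0 (R : realType) n (rho : R) (x : 'rV[R]_n) :
  0 <= ball_ind rho x.
Proof. by rewrite /ball_ind. Qed.

Lemma measurable_ball_ind (R : realType) n (rho : R) :
  measurable_fun setT
    (fun t : n.-tuple (measurableTypeR R) => ball_ind rho (row_of_tuple t)).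
Proof.
rewrite (_ : (fun _ => _) = \1_[set t : n.-tuple (measurableTypeR R) |
    enorm (row_of_tuple t) <= rho]); last first.
  by apply/funext => t; rewrite indicE mem_setE.
apply: measurable_indic; rewrite -[X in measurable X]setTI.
have mb := measurable_fun_ler (@measurable_enorm_row R n) (measurable_cst rho).
by have := mb measurableT [set true]; rewrite preimage_true; apply.
Qed.

(** Comparison with the integrable function exp(rho^2 - |x|^2), which is at least 1 on the ball. *)
Lemma integrable_ball_ind (R : realType) n (rho : R) :
  (lebesgue_tuple R n).-integrable setT
    (fun t => (ball_ind rho (row_of_tuple t))%:E).
Proof.
have mG : measurable_fun setT (fun t : n.-tuple (measurableTypeR R) =>
    (expR (- (1 * tuple_sqnorm t)))%:E).
  apply/measurable_EFinP; apply: measurableT_comp => //.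
  by apply: measurable_funN; apply: measurable_funM => //;
    exact: measurable_tuple_sqnorm.
apply: (@le_integrable _ _ _ _ _ measurableT _
  (fun t : n.-tuple (measurableTypeR R) => ((expR (rho ^+ 2))%:E * (expR (- (1
    * tuple_sqnorm t)))%:E)%E)).
- by apply/measurable_EFinP; exact: measurable_ball_ind.
- move=> t _; rewrite -EFinM !abse_EFin lee_fin !ger0_norm ?ball_ind_ge0//.
  rewrite /ball_ind mul1r -expRD enorm_row_of_tuple.
  case: (leP (Num.sqrt _) rho) => /= [h|_]; last exact: expR_ge0.
  rewrite -[leLHS]expR0 ler_expR subr_ge0.
  rewrite -(sqr_sqrtr (tuple_sqnorm_ge0 t)) lerXn2r ?nnegrE ?sqrtr_ge0//.
  exact: le_trans h.
- apply: integrableZl => //; apply/integrableP; split=> //.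
  rewrite (eq_integral (fun t => (expR (- (1 * tuple_sqnorm t)))%:E));
    last first.
    by move=> t _; rewrite gee0_abs// lee_fin expR_ge0.
  by rewrite integral_gauss_tuple// ltry.
Qed.

(* Integrating the Poisson kernel [y / (y ^ 2 + |x| ^ 2) ^ (n.+1 / 2)] over
   [y <= rho] bounds the integral of [|x| ^ (1 - n)] over the ball. *)
Lemma integrable_weight (R : realType) n (rho : R) :
  (lebesgue_tuple R n).-integrable setT
    (fun t => (ball_ind rho (row_of_tuple t) *
      (enorm (row_of_tuple t) ^+ 2 / enorm (row_of_tuple t) ^+ n.+1))%:E).
Proof.
pose G (z : measurableTypeR R * n.-tuple (measurableTypeR R)) : \bar R :=
  (\1_(`]0, rho]%classic : set R) z.1 *
   (z.1 * (Num.sqrt (z.1 ^+ 2 + tuple_sqnorm z.2) ^+ n.+1)^-1))%:E.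
have G0 z : (0 <= G z)%E.
  rewrite lee_fin indicE.
  have [|_] := boolP (_ \in _); last by rewrite mul0r.
  rewrite mem_setE in_itv /= mul1r => /andP[z0 _].
  by rewrite mulr_ge0 ?invr_ge0 ?exprn_ge0 ?sqrtr_ge0// ltW.
have mG : measurable_fun setT G.
  apply/measurable_EFinP; apply: measurable_funM.
    by apply: measurableT_comp => //; exact: measurable_indic.
  apply: measurable_funM => //; apply: measurable_inv_ge0.
    by move=> z; rewrite exprn_ge0// sqrtr_ge0.
  apply: measurable_funX; apply: measurable_sqrt; apply: measurable_funD.
    exact: measurable_funX.
  exact: (measurableT_comp (@measurable_tuple_sqnorm R n)).
(* By [integral_sqrt_poisson] all slices 0 < y <= rho have the same mass, so the double integral is
   that mass times the length of the interval. *)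
have GE : (\int[lebesgue_measure]_y \int[lebesgue_tuple R n]_t G (y, t) <
  +oo)%E.
  rewrite (eq_integral (fun y : measurableTypeR R => ((sphere_area R n.+1 /
    2)%:E *
      (\1_(`]0, rho]%classic : set R) y)%:E)%E)); last first.
    move=> y _; rewrite /G /= indicE.
    have [|_] := boolP (_ \in _); last first.
      by rewrite mule0; apply: integral0_eq => t _; rewrite mul0r.
    rewrite mem_setE in_itv /= => /andP[y0 _].
    under eq_integral do rewrite mul1r EFinM.
    rewrite ge0_integralZl//; last 2 first.
    - apply/measurable_EFinP; apply: measurable_inv_ge0.
        by move=> z; rewrite exprn_ge0// sqrtr_ge0.
      apply: measurable_funX; apply: measurable_sqrt;
        apply: measurable_funD => //.
      exact: measurable_tuple_sqnorm.
    - by rewrite lee_fin ltW.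
    rewrite integral_sqrt_poisson// mule1 -EFinM; congr EFin; field.
    by rewrite gt_eqF.
  rewrite ge0_integralZl//; last 2 first.
  - by apply/measurable_EFinP; exact: measurable_indic.
  - by rewrite lee_fin divr_ge0// ltW// sphere_area_gt0.
  rewrite integral_indic//= setIT lebesgue_measure_itv /= lte_fin.
  by case: ifP => _; rewrite ?mule0 ?ltry// -EFinB -EFinM ltry.
have mW : measurable_fun setT (fun t : n.-tuple (measurableTypeR R) =>
   (ball_ind rho (row_of_tuple t) *
      (enorm (row_of_tuple t) ^+ 2 / enorm (row_of_tuple t) ^+ n.+1))).
  apply: measurable_funM; first exact: measurable_ball_ind.
  apply: measurable_funM; first by apply: measurable_funX;
    exact: measurable_enorm_row.
  apply: measurable_inv_ge0; first by move=> t; rewrite exprn_ge0// sqrtr_ge0.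
  by apply: measurable_funX; exact: measurable_enorm_row.
(* For r = |x| with 0 < r <= rho, restrict the y-integral to [r/2, r]: there y >= r/2 and sqrt(y^2 +
   r^2) <= 2 r, and the interval has length r/2. The integral is thus at least (r/2)^2 / (2
   r)^(n+1), which accounts for the factor 4 * 2^(n+1). *)
have C0 : 0 <= 4 * 2 ^+ n.+1 :> R by rewrite mulr_ge0// exprn_ge0.
apply/integrableP; split; first exact/measurable_EFinP.
apply: (@le_lt_trans _ _ (\int[lebesgue_tuple R n]_t
    ((4 * 2 ^+ n.+1)%:E * \int[lebesgue_measure]_y G (y, t))))%E; last first.
  rewrite ge0_integralZl//; last 2 first.
  - by apply: measurable_fun_fubini_tonelli_G.
  - by move=> t _; apply: integral_ge0 => y _.
  by rewrite -fubini_tonelli// lte_mul_pinfty.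
apply: ge0_le_integral => //.
- by apply: measurableT_comp => //; exact/measurable_EFinP.
- by apply: measurable_funeM; apply: measurable_fun_fubini_tonelli_G.
move=> t _; set r := enorm (row_of_tuple t).
have r0 : 0 <= r by exact: sqrtr_ge0.
rewrite abse_EFin ger0_norm ?mulr_ge0 ?ball_ind_ge0 ?invr_ge0 ?exprn_ge0//.
have I0 : (0 <= \int[lebesgue_measure]_y G (y, t))%E by apply: integral_ge0.
have := r0; rewrite le_eqVlt => /predU1P[<-|rgt0].
  by rewrite expr0n /= mul0r mulr0 mule_ge0.
rewrite /ball_ind -/r; have [rrho|_] := leP r rho;
  last by rewrite mul0r mule_ge0.
rewrite mul1r.
have nE : tuple_sqnorm t = r ^+ 2.
  by rewrite /r enorm_row_of_tuple sqr_sqrtr// tuple_sqnorm_ge0.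
apply: (@le_trans _ _ ((4 * 2 ^+ n.+1)%:E * (\int[lebesgue_measure]_y
   ((r / 2 * ((2 * r) ^+ n.+1)^-1)%:E * (\1_(`[r / 2, r]%classic : set R)
     y)%:E)))%E).
  rewrite ge0_integralZl//; last 2 first.
  - by apply/measurable_EFinP; exact: measurable_indic.
  - by rewrite lee_fin mulr_ge0 ?invr_ge0 ?exprn_ge0 ?mulr_ge0.
  rewrite integral_indic//= setIT lebesgue_measure_itv /= lte_fin.
  rewrite ifT; last by lra.
  rewrite -EFinB -!EFinM lee_fin exprMn le_eqVlt; apply/orP; left; apply/eqP.
  by field; rewrite !expf_neq0// gt_eqF.
apply: lee_wpmul2l; first by rewrite lee_fin.
apply: ge0_le_integral => //.
- by move=> y _; rewrite -EFinM lee_fin indicE !mulr_ge0 ?invr_ge0 ?exprn_ge0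
    ?mulr_ge0.
- by apply: measurable_funeM; apply/measurable_EFinP; exact: measurable_indic.
- by apply: (measurableT_comp mG); exact: measurable_fun_pair.
move=> y _; rewrite -EFinM /G lee_fin !indicE /=.
have [|_] := boolP (y \in (`[_, _]%classic)); last first.
  by rewrite mulr0; have := G0 (y, t); rewrite /G lee_fin indicE.
rewrite mem_setE in_itv /= => /andP[y1 y2].
have y0 : 0 < y by apply: lt_le_trans y1; rewrite divr_gt0.
rewrite mulr1 mem_set /=; last by rewrite in_itv /= y0 (le_trans y2).
rewrite mul1r nE; apply: ler_pM => //.
  by rewrite divr_ge0.
  by rewrite invr_ge0 exprn_ge0// mulr_ge0.
rewrite lef_pV2 ?posrE ?exprn_gt0 ?mulr_gt0// ?sqrtr_gt0 ?addr_gt0 ?exprn_gt0//.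
rewrite lerXn2r ?nnegrE ?sqrtr_ge0 ?mulr_ge0//.
rewrite -(@ler_sqr _ (Num.sqrt _)) ?nnegrE ?sqrtr_ge0 ?mulr_ge0//.
rewrite sqr_sqrtr ?addr_ge0 ?sqr_ge0// exprMn.
have : y ^+ 2 <= r ^+ 2 by rewrite lerXn2r ?nnegrE ?(ltW y0).
have := sqr_ge0 r; lra.
Qed.

(** * Integrals of functions of a row vector *)

Definition measurable_rV (R : realType) n (g : 'rV[R]_n -> R) :=
  measurable_fun setT (g \o @row_of_tuple R n).

Definition integrable_rV (R : realType) n (g : 'rV[R]_n -> R) :=
  (lebesgue_tuple R n).-integrable setT (EFin \o (g \o @row_of_tuple R n)).

Lemma integral_rVT (R : realType) n (g : 'rV[R]_n -> R) :
  integral_rV setT g = \int[lebesgue_tuple R n]_t (g \o @row_of_tuple R n) t.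
Proof. by []. Qed.

Lemma integral_rV_mkcond (R : realType) n D (g : 'rV[R]_n -> R) :
  integral_rV D g = integral_rV setT (fun x => \1_D x * g x).
Proof.
rewrite /integral_rV Rintegral_mkcond preimage_setT; apply: eq_Rintegral => t _.
rewrite patchE indicE.
have [h|h] := boolP (\row_i tnth t i \in D).
  by rewrite ifT ?mul1r//; exact: h.
by rewrite ifF ?mul0r//; exact/negbTE.
Qed.

Lemma integrable_rV_measurable (R : realType) n (g : 'rV[R]_n -> R) :
  integrable_rV g -> measurable_rV g.
Proof. by move=> /measurable_int /measurable_EFinP. Qed.

Lemma le_integrable_rV (R : realType) n (g h : 'rV[R]_n -> R) :
  measurable_rV g -> (forall x, `|g x| <= h x) ->
  integrable_rV h -> integrable_rV g.
Proof.
move=> mg gh; apply: le_integrable => //; first exact/measurable_EFinP.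
by move=> t _ /=; rewrite lee_fin (le_trans (gh _))// ler_norm.
Qed.

Lemma integrable_rVZl (R : realType) n (c : R) (g : 'rV[R]_n -> R) :
  integrable_rV g -> integrable_rV (fun x => c * g x).
Proof. by move=> ig; apply: (integrableZl measurableT c ig). Qed.

Lemma integrable_rVD (R : realType) n (g h : 'rV[R]_n -> R) :
  integrable_rV g -> integrable_rV h -> integrable_rV (fun x => g x + h x).
Proof. by move=> ig ih; apply: (integrableD measurableT ig ih). Qed.

Lemma integral_rVZl (R : realType) n (c : R) (g : 'rV[R]_n -> R) :
  integrable_rV g ->
  integral_rV setT (fun x => c * g x) = c * integral_rV setT g.
Proof. by move=> ig; rewrite !integral_rVT -RintegralZl. Qed.

Lemma integral_rVD (R : realType) n (g h : 'rV[R]_n -> R) :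
  integrable_rV g -> integrable_rV h ->
  integral_rV setT (fun x => g x + h x) = integral_rV setT g + integral_rV setT
    h.
Proof. by move=> ig ih; rewrite !integral_rVT -RintegralD. Qed.

Lemma integrable_rV0 (R : realType) n : integrable_rV (fun _ : 'rV[R]_n => 0).
Proof. by have := @integrable0 _ _ R (lebesgue_tuple R n) setT. Qed.

Lemma integrable_rV_sum (R : realType) n (I : Type) (s : seq I)
    (g : I -> 'rV[R]_n -> R) : (forall i, integrable_rV (g i)) ->
  integrable_rV (fun x => \sum_(i <- s) g i x).
Proof.
move=> ig; elim: s => [|i s IHs].
  by under eq_fun do rewrite big_nil; exact: integrable_rV0.
by under eq_fun do rewrite big_cons; exact: integrable_rVD.
Qed.

Lemma integral_rV_sum (R : realType) n (I : Type) (s : seq I)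
    (g : I -> 'rV[R]_n -> R) : (forall i, integrable_rV (g i)) ->
  integral_rV setT (fun x => \sum_(i <- s) g i x) =
  \sum_(i <- s) integral_rV setT (g i).
Proof.
move=> ig; elim: s => [|i s IHs].
  under eq_fun do rewrite big_nil.
  by rewrite big_nil integral_rVT Rintegral_cst// mul0r.
rewrite big_cons -IHs -integral_rVD//; last exact: integrable_rV_sum.
by congr integral_rV; apply/funext => x; rewrite big_cons.
Qed.

Lemma ler_norm_integral_rV (R : realType) n (g h : 'rV[R]_n -> R) :
  measurable_rV g -> (forall x, `|g x| <= h x) -> integrable_rV h ->
  `|integral_rV setT g| <= integral_rV setT h.
Proof.
move=> mg gh ih; have ig := le_integrable_rV mg gh ih.
rewrite !integral_rVT (le_trans (le_normr_Rintegral _ _))//.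
apply: le_Rintegral => //; last by move=> t _ /=; exact: gh.
exact: (integrable_norm ig).
Qed.

Lemma integral_rV_opp (R : realType) n (g : 'rV[R]_n -> R) : measurable_rV g ->
  integral_rV setT (fun x => g (- x)) = integral_rV setT g.
Proof.
move=> mg; rewrite !integral_rVT -[RHS]Rintegral_tuple_opp//.
by apply: eq_Rintegral => t _; rewrite /= row_of_tuple_opp.
Qed.

Lemma measurable_rV_opp (R : realType) n (g : 'rV[R]_n -> R) :
  measurable_rV g -> measurable_rV (fun x => g (- x)).
Proof.
move=> mg; rewrite /measurable_rV.
rewrite (_ : _ \o _ = (g \o @row_of_tuple R n) \o @tuple_opp R n).
  exact: (measurableT_comp mg (@measurable_tuple_opp R n)).
by apply/funext => t /=; rewrite row_of_tuple_opp.
Qed.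

Lemma cvg_integral_rV (R : realType) n (g_ : nat -> 'rV[R]_n -> R)
    (g h : 'rV[R]_n -> R) :
  (forall k, measurable_rV (g_ k)) ->
  (forall x, g_ k x @[k --> \oo] --> g x) ->
  integrable_rV h -> (forall k x, `|g_ k x| <= h x) ->
  integral_rV setT (g_ k) @[k --> \oo] --> integral_rV setT g.
Proof.
move=> mg_ g_g ih g_h.
have mg : measurable_rV g.
  apply: (measurable_fun_cvg mg_) => t _; exact: g_g.
(* The bound passes to the limit, so the limit is integrable; this is what makes [fine] continuous
   at the limiting integral. *)
have ig : integrable_rV g.
  apply: le_integrable_rV mg _ ih => x.
  have cn : `|g_ k x| @[k --> \oo] --> `|g x| by apply: cvg_norm; exact: g_g.
  rewrite -(cvg_lim _ cn)//; apply: limr_le; first by apply/cvg_ex; eexists;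
    exact: cn.
  by near=> k; exact: g_h.
have cg : (\int[lebesgue_tuple R n]_t (g_ k (row_of_tuple t))%:E @[k --> \oo]
    --> \int[lebesgue_tuple R n]_t (g (row_of_tuple t))%:E)%E.
  apply: (@dominated_cvg _ _ R (lebesgue_tuple R n) setT measurableT
    (fun k => EFin \o (g_ k \o @row_of_tuple R n)) (EFin \o (g \o @row_of_tuple
      R n))
    (EFin \o (h \o @row_of_tuple R n))) => //.
  - by move=> k; apply/measurable_EFinP; exact: mg_.
  - by move=> t _; apply/fine_cvgP; split; [exact: nearW|exact: g_g].
  - by move=> k t _ /=; rewrite lee_fin.
apply: fine_cvg; rewrite fineK//.
exact: (integrable_fin_num measurableT ig).
Unshelve. all: by end_near. Qed.


Lemma measurable_rV_coord (R : realType) n j :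
  measurable_rV (fun x : 'rV[R]_n => x ord0 j).
Proof.
rewrite /measurable_rV (_ : _ \o _ = fun t => tnth t j).
  exact: measurable_tnth.
by apply/funext => t /=; rewrite row_of_tupleE.
Qed.

Lemma enorm_ge0 (R : realType) n (x : 'rV[R]_n) : 0 <= enorm x.
Proof. exact: sqrtr_ge0. Qed.

Lemma enorm_sqr (R : realType) n (x : 'rV[R]_n) :
  enorm x ^+ 2 = \sum_j x ord0 j ^+ 2.
Proof. by rewrite sqr_sqrtr// sumr_ge0// => j _; exact: sqr_ge0. Qed.

Lemma enormN (R : realType) n (x : 'rV[R]_n) : enorm (- x) = enorm x.
Proof. by rewrite /enorm; under eq_bigr do rewrite mxE sqrrN. Qed.

Lemma ler_coord_enorm (R : realType) n (x : 'rV[R]_n) j :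
  `|x ord0 j| <= enorm x.
Proof.
rewrite -sqrtr_sqr /enorm ler_wsqrtr// (bigD1 j)//= lerDl sumr_ge0// => i _.
exact: sqr_ge0.
Qed.

Lemma enorm_eq0 (R : realType) n (x : 'rV[R]_n) : (enorm x == 0) = (x == 0).
Proof.
apply/eqP/eqP => [x0|->].
  apply/rowP => j; rewrite mxE; apply/eqP; rewrite -normr_le0 -x0.
  exact: ler_coord_enorm.
by rewrite /enorm big1 ?sqrtr0// => j _; rewrite mxE expr0n.
Qed.

Lemma cvg_sumr (R : realType) (T : Type) (F : set_system T) {FF : Filter F}
    (I : Type) (s : seq I) (f : I -> T -> R) (l : I -> R) :
  (forall i, f i t @[t --> F] --> l i) ->
  \sum_(i <- s) f i t @[t --> F] --> \sum_(i <- s) l i.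
Proof.
move=> fl; elim: s => [|i s IHs].
  by rewrite big_nil; under eq_fun do rewrite big_nil; exact: cvg_cst.
by rewrite big_cons; under eq_fun do rewrite big_cons; exact: cvgD.
Qed.

Lemma continuous_enorm (R : realType) n : continuous (@enorm R n).
Proof.
move=> x; apply: (@continuous_comp _ _ _ (fun x : 'rV[R]_n => \sum_j x ord0 j
  ^+ 2) Num.sqrt); last exact: sqrt_continuous.
apply: (@cvg_sumr R _ (nbhs x) (nbhs_filter x)) => j;
  apply: (@continuous_comp _ _ _ (fun x : 'rV[R]_n => x ord0 j) (fun r => r ^+
    2)).
  exact: coord_continuous.
exact: exprn_continuous.
Qed.

Lemma bounded_continuous_on_compact (R : realType) (T : topologicalType)
    (K : set T) (g : T -> R) : compact K -> continuous g ->
  exists M, forall x, K x -> `|g x| <= M.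
Proof.
move=> cK cg.
have /compact_bounded [M [_ HM]] : compact (g @` K).
  by apply: continuous_compact => //; exact: continuous_subspaceT.
exists (M + 1) => x Kx; apply: (HM (M + 1)); [by rewrite ltrDl|by exists x].
Qed.

(** * Pairing test functions with even and odd kernels *)

Section TestFunction.
Variables (R : realType) (m : nat).
Implicit Types (f g : 'rV[R]_m -> R).

Definition supported_in_ball rho f := forall x, f x != 0 -> enorm x <= rho.

Lemma supported_ball_indM rho f x : supported_in_ball rho f ->
  f x = ball_ind rho x * f x.
Proof.
move=> sf; rewrite /ball_ind; case: (leP (enorm x) rho) => h;
  first by rewrite mul1r.
rewrite mul0r; apply/eqP/negPn/negP => /sf; by rewrite leNgt h.
Qed.

Lemma test_function_continuous f : test_function f -> continuous f.
Proof. by move=> [sf _] x; apply: differentiable_continuous;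
  exact: (sf [::]). Qed.

Lemma compact_enorm_bounded (K : set 'rV[R]_m) : compact K ->
  exists rho, 0 <= rho /\ forall x, K x -> enorm x <= rho.
Proof.
move=> cK; have [M HM] := bounded_continuous_on_compact cK (@continuous_enorm R
  m).
exists `|M|; split => // x /HM h; apply: le_trans (ler_norm M).
by rewrite ger0_norm ?enorm_ge0 in h.
Qed.

Lemma tsupport_supported f (K : set 'rV[R]_m) rho : tsupport f `<=` K ->
  (forall x, K x -> enorm x <= rho) -> supported_in_ball rho f.
Proof. by move=> fK Krho x fx; apply: Krho; apply: fK;
  exact: subset_closure. Qed.

Lemma test_function_supported f : test_function f ->
  exists rho, 0 <= rho /\ supported_in_ball rho f.
Proof.
move=> [_ cf]; have [rho [rho0 Hrho]] := compact_enorm_bounded cf.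
by exists rho; split => //; exact: (tsupport_supported (@subset_refl _ _)).
Qed.

Lemma test_function_bounded f : test_function f -> exists M, forall x, `|f x|
  <= M.
Proof.
move=> tf; have [M HM] := bounded_continuous_on_compact tf.2
  (test_function_continuous tf).
exists `|M| => x; have [->|fx] := eqVneq (f x) 0; first by rewrite normr0.
by apply: le_trans (ler_norm M); apply: HM; exact: subset_closure.
Qed.

Lemma measurable_rV_continuous f : continuous f -> measurable_rV f.
Proof. exact: measurable_continuous_row. Qed.

Lemma derive_rV f x (v : 'rV[R]_m) : differentiable f x ->
  'D_v f x = \sum_j v ord0 j * 'D_(delta_mx ord0 j) f x.
Proof.
move=> df; rewrite {1}(row_sum_delta v) deriveE// linear_sum.
by apply: eq_bigr => j _; rewrite linearZ deriveE.
Qed.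

(* Mean value theorem on the segment from [- x] to [x]. *)
Lemma odd_part_bound f B x : (forall y, differentiable f y) ->
  (forall j y, enorm y <= enorm x -> `|'D_(delta_mx ord0 j) f y| <= B) ->
  `|2^-1 * (f x - f (- x))| <= m%:R * B * enorm x.
Proof.
move=> df HB.
pose g (s : R) := f (s *: x).
have dg (s : R) : is_derive s 1 g ('D_x f (s *: x)).
  have E : (fun h => h^-1 *: ((g \o shift s) (h *: 1) - g s)) =
      (fun h => h^-1 *: ((f \o shift (s *: x)) (h *: x) - f (s *: x))).
    by apply/funext => h; rewrite /= /g scalerDl [h *: 1]mulr1.
  apply: DeriveDef; last by rewrite /derive E.
  by rewrite /derivable E; exact/diff_derivable.
(* The segment [-1, 1] has length 2, which cancels the factor 1/2 of the odd part. *)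
have [||c] := @MVT_segment R g (fun s => 'D_x f (s *: x)) (-1) 1.
- by lra.
- apply: continuous_subspaceT => s; apply: differentiable_continuous.
  apply/derivable1_diffP; exact: ex_derive.
rewrite in_itv /= => /andP[c1 c2]; rewrite /g scale1r scaleN1r => ->.
have cx : enorm (c *: x) <= enorm x.
  rewrite /enorm; under eq_bigr do rewrite mxE exprMn.
  rewrite -mulr_sumr sqrtrM ?sqr_ge0// sqrtr_sqr ler_piMl ?sqrtr_ge0//.
  by rewrite ler_norml c1.
rewrite opprK (_ : 2^-1 * _ = 'D_x f (c *: x)); last by field.
rewrite derive_rV// (le_trans (ler_norm_sum _ _ _))//.
rewrite [leRHS](_ : _ = \sum_(j < m) (enorm x * B)); last first.
  by rewrite sumr_const card_ord -mulr_natl; ring.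
apply: ler_sum => j _; rewrite normrM ler_pM// ?ler_coord_enorm// HB//.
Qed.

Lemma differentiable_partials_bounded f rho : smooth f ->
  exists B, 0 <= B /\ forall j x, enorm x <= rho -> `|'D_(delta_mx ord0 j) f x|
    <= B.
Proof.
move=> sf.
(* The Euclidean ball of radius [rho] lies in this cube, which is compact as a product of
   segments. *)
have cK : compact [set x : 'rV[R]_m | forall i, `[- rho, rho]%classic (x ord0
  i)].
  by apply: (@rV_compact R m (fun _ => `[- rho, rho]%classic)) => i;
    exact: segment_compact.
have H j : exists M, forall x, enorm x <= rho -> `|'D_(delta_mx ord0 j) f x| <=
  M.
  have [M HM] := @bounded_continuous_on_compact R _ _ ('D_(delta_mx ord0 j) f)
    cK
    (fun x => differentiable_continuous (sf [:: j] x)).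
  exists M => x xrho; apply: HM => i /=; rewrite in_itv /= -ler_norml.
  exact: le_trans (ler_coord_enorm _ _) xrho.
exists (\sum_j `|sval (cid (H j))|); split; first exact: sumr_ge0.
move=> j x xrho; rewrite (bigD1 j)//=.
apply: le_trans (le_trans (svalP (cid (H j)) x xrho) (ler_norm _)) _.
by rewrite lerDl sumr_ge0.
Qed.

End TestFunction.

(** * The radial factor of the Cauchy kernel *)

Section Kernel.
Variables (R : realType) (m : nat).
Implicit Types (f : 'rV[R]_m -> R) (x : 'rV[R]_m) (y : R).

(** Multiplied by [y] it is the Poisson kernel up to normalisation; multiplied by a coordinate of
    [x] it is a component of the vector part of the Cauchy kernel. *)
Definition kern y x : R := (pnorm (y, x) ^+ m.+1)^-1.

Lemma pnorm_ge0 (p : R * 'rV[R]_m) : 0 <= pnorm p.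
Proof. exact: sqrtr_ge0. Qed.

Lemma kern_ge0 y x : 0 <= kern y x.
Proof. by rewrite invr_ge0 exprn_ge0// pnorm_ge0. Qed.

Lemma kernN y x : kern y (- x) = kern y x.
Proof. by rewrite /kern /pnorm /= enormN. Qed.

Lemma kernNl y x : kern (- y) x = kern y x.
Proof. by rewrite /kern /pnorm /= sqrrN. Qed.

Lemma ler_enorm_pnorm y x : enorm x <= pnorm (y, x).
Proof.
rewrite -[leLHS]ger0_norm ?enorm_ge0// -sqrtr_sqr ler_wsqrtr//= lerDr.
exact: sqr_ge0.
Qed.

Lemma ler_norm_pnorm y x : `|y| <= pnorm (y, x).
Proof. by rewrite -sqrtr_sqr ler_wsqrtr//= lerDl sqr_ge0. Qed.

Lemma kern_le_enorm y x : x != 0 -> kern y x <= (enorm x ^+ m.+1)^-1.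
Proof.
move=> x0; have e0 : 0 < enorm x by rewrite lt_neqAle enorm_ge0 eq_sym
  enorm_eq0 x0.
rewrite lef_pV2 ?posrE ?exprn_gt0//;
  last exact: lt_le_trans (ler_enorm_pnorm _ _).
by rewrite lerXn2r ?nnegrE ?enorm_ge0 ?pnorm_ge0// ler_enorm_pnorm.
Qed.

Lemma kern_le_norm y x : y != 0 -> kern y x <= (`|y| ^+ m.+1)^-1.
Proof.
rewrite -normr_gt0 => y0.
rewrite lef_pV2 ?posrE ?exprn_gt0//;
  last exact: lt_le_trans (ler_norm_pnorm _ _).
by rewrite lerXn2r ?nnegrE ?pnorm_ge0// ler_norm_pnorm.
Qed.

Lemma measurable_rV_kern y : measurable_rV (kern y).
Proof.
apply: measurable_inv_ge0; first by move=> t; rewrite exprn_ge0// pnorm_ge0.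
apply: measurable_funX; apply: measurable_sqrt; apply: measurable_funD => /=.
  exact: measurable_cst.
by apply: measurable_funX; exact: measurable_enorm_row.
Qed.

Lemma cvg_kern0 (u : nat -> R) x : u k @[k --> \oo] --> 0 -> x != 0 ->
  kern (u k) x @[k --> \oo] --> (enorm x ^+ m.+1)^-1.
Proof.
move=> u0 x0; apply: cvgV; first by rewrite expf_neq0// enorm_eq0.
have ce k (a : R) : {for a, continuous (fun r : R => r ^+ k)}.
  exact: exprn_continuous.
suff h : pnorm (u k, x) @[k --> \oo] --> enorm x by exact: (cvg_comp _ _ h (ce
  _ _)).
rewrite -[X in _ --> X]ger0_norm ?enorm_ge0// -sqrtr_sqr.
suff h : u k ^+ 2 + enorm x ^+ 2 @[k --> \oo] --> enorm x ^+ 2.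
  exact: (cvg_comp _ _ h (@sqrt_continuous R _)).
rewrite -[X in _ --> X]add0r; apply: cvgD; last exact: cvg_cst.
rewrite [X in _ --> X](_ : 0 = 0 ^+ 2); last by rewrite expr0n.
exact: (cvg_comp _ _ u0 (ce _ _)).
Qed.

Lemma integral_kern_ereal y : 0 < y ->
  (\int[lebesgue_tuple R m]_t (kern y (row_of_tuple t))%:E =
   (sphere_area R m.+1 / 2 / y)%:E)%E.
Proof.
move=> y0; rewrite -integral_sqrt_poisson//; apply: eq_integral => t _.
by rewrite /kern /pnorm /= enorm_row_of_tuple sqr_sqrtr// tuple_sqnorm_ge0.
Qed.

Lemma integrable_kern y : 0 < y -> integrable_rV (kern y).
Proof.
move=> y0; apply/integrableP; split.
  apply/measurable_EFinP; exact: measurable_rV_kern.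
rewrite (eq_integral (fun t : m.-tuple (measurableTypeR R) =>
    (kern y (row_of_tuple t))%:E)); last first.
  by move=> t _; rewrite gee0_abs// lee_fin kern_ge0.
by rewrite integral_kern_ereal// ltry.
Qed.

Lemma integral_kern y : 0 < y ->
  integral_rV setT (kern y) = sphere_area R m.+1 / 2 / y.
Proof. by move=> y0; rewrite integral_rVT /Rintegral integral_kern_ereal. Qed.

Lemma integrable_rV_bounded_ball rho M f : measurable_rV f ->
  supported_in_ball rho f -> (forall x, `|f x| <= M) -> integrable_rV f.
Proof.
move=> mf sf fM; apply: (@le_integrable_rV _ _ _ (fun x => M * ball_ind rho x)
  mf).
  move=> x; rewrite (supported_ball_indM x sf) normrM mulrC.
  by rewrite (ger0_norm (ball_ind_ge0 _ _)) ler_wpM2r ?ball_ind_ge0.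
by apply: integrable_rVZl; exact: integrable_ball_ind.
Qed.

(** Approximate identity: f(0) times the exact mass is subtracted and the rest is split at |x| = d.
    Continuity handles the inside; outside, the kernel is bounded by a multiple of the kernel at
    height 1, uniformly in the height, and the prefactor [u k] sends this part to 0. *)
Lemma cvg_poisson f (M : R) (u : nat -> R) : continuous f ->
  (forall x, `|f x| <= M) -> (forall k, 0 < u k) -> u k @[k --> \oo] --> 0 ->
  u k * integral_rV setT (fun x => f x * kern (u k) x) @[k --> \oo] -->
    f 0 * (sphere_area R m.+1 / 2).
Proof.
move=> cf fM u0 cu; set sg := sphere_area R m.+1.
have sg0 : 0 < sg by exact: sphere_area_gt0.
have mf := measurable_rV_continuous cf.
have M0 : 0 <= M := le_trans (normr_ge0 _) (fM 0).
have ik (y : R) : 0 < y -> integrable_rV (fun x => f x * kern y x).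
  move=> y0; apply: (@le_integrable_rV _ _ _ (fun x => M * kern y x)).
  - by apply: measurable_funM => //; exact: measurable_rV_kern.
  - by move=> x; rewrite normrM (ger0_norm (kern_ge0 _ _)) ler_wpM2r// kern_ge0.
  - exact/integrable_rVZl/integrable_kern.
apply/cvgrPdist_le => e e0.
(* The kernel times its height has mass [sg / 2], so this tolerance costs e/2 and leaves e/2 for the
   outer part. *)
have eta0 : 0 < e / sg by rewrite divr_gt0.
have [d d0 Hd] : exists2 d, 0 < d & forall x, enorm x < d -> `|f x - f 0| <= e
  / sg.
  have /cvgrPdist_le/(_ _ eta0)/nbhs_ballP[d /= d0 Hd] := cf 0.
  exists d => // x xd; rewrite distrC; apply: Hd; split=> // i j.
  rewrite /ball /= mxE sub0r normrN (ord1 i).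
  exact: le_lt_trans (ler_coord_enorm _ _) xd.
(* [2 * M] bounds |f(x) - f(0)|. For |x| >= d one has sqrt(1 + |x|^2) <= (1/d + 1) |x|, hence
   |x|^(-m-1) <= (1/d + 1)^(m+1) [kern 1 x]. *)
pose C := 2 * M * (d^-1 + 1) ^+ m.+1.
have C0 : 0 <= C by rewrite !mulr_ge0// exprn_ge0// addr_ge0// invr_ge0 ltW.
have pw (y : R) x : `|(f x - f 0) * kern y x| <= e / sg * kern y x + C * kern 1
  x.
  rewrite normrM (ger0_norm (kern_ge0 _ _)).
  have [xd|dx] := ltP (enorm x) d.
    rewrite -[leLHS]addr0 lerD//; last by rewrite mulr_ge0// kern_ge0.
    by rewrite ler_wpM2r ?kern_ge0// Hd.
  rewrite -[leLHS]add0r lerD//; first by rewrite mulr_ge0 ?kern_ge0// ltW.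
  have ex0 : 0 < enorm x by exact: lt_le_trans dx.
  have x0 : x != 0 by rewrite -enorm_eq0 gt_eqF.
  rewrite /C -mulrA ler_pM ?normr_ge0 ?kern_ge0//.
    by rewrite (le_trans (ler_normB _ _))// mulr2n mulrDl !mul1r lerD.
  rewrite (le_trans (kern_le_enorm _ x0))//.
  have p1 : 0 < pnorm (1, x) by exact: lt_le_trans (ler_enorm_pnorm _ _).
  rewrite -ler_pdivrMl; last by rewrite exprn_gt0// addr_gt0// invr_gt0.
  rewrite /kern -invfM -exprMn lef_pV2 ?posrE ?exprn_gt0// ?mulr_gt0 ?addr_gt0
    ?invr_gt0//.
  rewrite lerXn2r ?nnegrE ?pnorm_ge0// ?mulr_ge0 ?addr_ge0 ?invr_ge0 ?enorm_ge0
    ?(ltW d0)//.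
  rewrite -(@ler_sqr _ (pnorm _)) ?nnegrE ?pnorm_ge0 ?mulr_ge0 ?addr_ge0
    ?invr_ge0 ?enorm_ge0 ?(ltW d0)//.
  rewrite sqr_sqrtr ?addr_ge0 ?sqr_ge0//= expr1n.
  have h1 : 1 <= enorm x / d by rewrite ler_pdivlMr// mul1r.
  have -> : (d^-1 + 1) * enorm x = enorm x / d + enorm x by ring.
  rewrite sqrrD lerD2r -[leLHS]addr0 lerD ?exprn_ege1//.
  by rewrite mulrn_wge0// !mulr_ge0 ?invr_ge0 ?(ltW ex0) ?(ltW d0).
have cC : u k * (C * (sg / 2)) @[k --> \oo] --> 0.
  by rewrite -[X in _ --> X](mul0r (C * (sg / 2))); apply: cvgMl.
near=> k.
have uk0 := u0 k.
have E : f 0 * (sg / 2) - u k * integral_rV setT (fun x => f x * kern (u k) x) =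
    - (u k * integral_rV setT (fun x => (f x - f 0) * kern (u k) x)).
  have -> : integral_rV setT (fun x => (f x - f 0) * kern (u k) x) =
     integral_rV setT (fun x => f x * kern (u k) x) - f 0 * integral_rV setT
       (kern (u k)).
    rewrite -mulNr -integral_rVZl; last exact: integrable_kern.
    rewrite -integral_rVD; last 2 first.
    - exact: ik.
    - by apply: integrable_rVZl; exact: integrable_kern.
    by congr integral_rV; apply/funext => x; ring.
  by rewrite integral_kern// -/sg; field; rewrite gt_eqF.
rewrite E normrN normrM gtr0_norm//.
apply: (@le_trans _ _ (u k * (e / sg * (sg / 2 / u k) + C * (sg / 2 / 1)))).
  rewrite ler_pM2l// -!integral_kern// -!integral_rVZl;
    try exact: integrable_kern.
  rewrite -integral_rVD; try by apply: integrable_rVZl; exact: integrable_kern.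
  apply: ler_norm_integral_rV.
  - apply: measurable_funM; last exact: measurable_rV_kern.
    by apply: measurable_funB.
  - exact: pw.
  - by apply: integrable_rVD; apply: integrable_rVZl; exact: integrable_kern.
have -> : u k * (e / sg * (sg / 2 / u k) + C * (sg / 2 / 1)) =
    e / 2 + u k * (C * (sg / 2)) by field; rewrite !gt_eqF.
rewrite [leRHS](splitr e) lerD2l.
apply: le_trans (ler_norm _) _.
near: k; have e20 : 0 < e / 2 by rewrite divr_gt0.
by have /cvgr0Pnorm_le/(_ _ e20) := cC.
Unshelve. all: by end_near. Qed.

(** An absolutely convergent form of the principal value of x_j / |x|^(m+1) applied to a test
    function: the kernel is odd, so only the odd part of [f] contributes, and its zero at the origin
    weakens the singularity by one order. *)
Definition odd_pairing j f : R := integral_rV setT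
  (fun x => 2^-1 * (f x - f (- x)) * (x ord0 j / enorm x ^+ m.+1)).

Definition ball_weight rho : R := integral_rV setT
  (fun x : 'rV[R]_m => ball_ind rho x * (enorm x ^+ 2 / enorm x ^+ m.+1)).

(** * Convergence of pairings with odd kernels *)

Section OddPairing.
Variables (f : 'rV[R]_m -> R) (rho M L : R).
Hypothesis cf : continuous f.
Hypothesis sf : supported_in_ball rho f.
Hypothesis fM : forall x, `|f x| <= M.
Hypothesis fL : forall x, enorm x <= rho -> `|2^-1 * (f x - f (- x))| <= L *
  enorm x.
Variable j : 'I_m.

Let mf := measurable_rV_continuous cf.

Lemma measurable_odd_kernel (k : 'rV[R]_m -> R) : measurable_rV k ->
  measurable_rV (fun x => 2^-1 * (f x - f (- x)) * (x ord0 j * k x)).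
Proof.
move=> mk; apply: measurable_funM.
  by apply: measurable_funM => //; apply: measurable_funB => //;
    exact: measurable_rV_opp.
by apply: measurable_funM => //; exact: measurable_rV_coord.
Qed.

(** The odd part and the coordinate each supply a factor |x|, which reduces |x|^(-m-1) to the
    integrable |x|^(1-m). *)
Lemma odd_kernel_bound (k : 'rV[R]_m -> R) x : 0 <= L ->
  (x != 0 -> `|k x| <= (enorm x ^+ m.+1)^-1) ->
  `|2^-1 * (f x - f (- x)) * (x ord0 j * k x)| <=
    L * (ball_ind rho x * (enorm x ^+ 2 / enorm x ^+ m.+1)).
Proof.
move=> L0 kx; have [->|x0] := eqVneq x 0.
  by rewrite mxE mul0r mulr0 normr0 !mulr_ge0 ?ball_ind_ge0 ?invr_ge0
    ?exprn_ge0 ?enorm_ge0.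
rewrite /ball_ind; case: (leP (enorm x) rho) => h; last first.
  have f0 z : enorm z = enorm x -> f z = 0.
    by move=> zx; apply/eqP/negPn/negP => /sf; rewrite zx leNgt h.
  by rewrite (f0 x)// (f0 (- x)) ?enormN// subrr mulr0 !mul0r normr0 mulr0.
rewrite mul1r normrM [`|_ * k x|]normrM expr2 !mulrA -mulrA.
rewrite -[leRHS]mulrA ler_pM ?normr_ge0 ?mulr_ge0 ?normr_ge0 ?fL//.
by rewrite ler_pM ?normr_ge0 ?ler_coord_enorm ?kx.
Qed.

Lemma measurable_enormV : measurable_rV (fun x => (enorm x ^+ m.+1)^-1).
Proof.
apply: measurable_inv_ge0; first by move=> t; rewrite exprn_ge0// enorm_ge0.
by apply: measurable_funX; exact: measurable_enorm_row.
Qed.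

Lemma odd_pairing_pointwise x : 0 <= L ->
  `|2^-1 * (f x - f (- x)) * (x ord0 j / enorm x ^+ m.+1)| <=
    L * (ball_ind rho x * (enorm x ^+ 2 / enorm x ^+ m.+1)).
Proof.
move=> L0; apply: (@odd_kernel_bound (fun x => (enorm x ^+ m.+1)^-1)) => // _.
by rewrite ger0_norm// invr_ge0 exprn_ge0// enorm_ge0.
Qed.

Lemma integrable_odd_pairing : 0 <= L -> integrable_rV
  (fun x => 2^-1 * (f x - f (- x)) * (x ord0 j / enorm x ^+ m.+1)).
Proof.
move=> L0; apply: (le_integrable_rV (measurable_odd_kernel measurable_enormV)).
  by move=> x; exact: odd_pairing_pointwise.
by apply: integrable_rVZl; exact: integrable_weight.
Qed.

Lemma odd_pairing_bound : 0 <= L -> `|odd_pairing j f| <= L * ball_weight rho.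
Proof.
move=> L0; rewrite /ball_weight -integral_rVZl; last exact: integrable_weight.
apply: ler_norm_integral_rV.
- exact: (measurable_odd_kernel measurable_enormV).
- by move=> x; exact: odd_pairing_pointwise.
- by apply: integrable_rVZl; exact: integrable_weight.
Qed.

(* Averaging over [x] and [- x] replaces [f] by its odd part, which makes the
   integrand dominated by an integrable function uniformly in [n]. *)
Lemma cvg_odd_pairing (k : nat -> 'rV[R]_m -> R) (c : nat -> R) : 0 <= L ->
  (forall n, measurable_rV (k n)) ->
  (forall n x, k n (- x) = k n x) ->
  (forall n x, `|k n x| <= c n) ->
  (forall n x, x != 0 -> `|k n x| <= (enorm x ^+ m.+1)^-1) ->
  (forall x, x != 0 -> k n x @[n --> \oo] --> (enorm x ^+ m.+1)^-1) ->
  integral_rV setT (fun x => f x * (x ord0 j * k n x)) @[n --> \oo] -->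
    odd_pairing j f.
Proof.
move=> L0 mk ke kc kb kl.
(* The bound [c n] may blow up with [n]: it only ensures that, for fixed [n], the integrand and its
   reflection can be integrated separately. *)
have ik n : integrable_rV (fun x => f x * (x ord0 j * k n x)).
  apply: (@integrable_rV_bounded_ball `|rho| (M * (`|rho| * c n))).
  - apply: measurable_funM => //; apply: measurable_funM; last exact: mk.
    exact: measurable_rV_coord.
  - move=> x; rewrite mulf_eq0 negb_or => /andP[/sf h _].
    exact: le_trans (ler_norm _).
  - move=> x; have [->|/sf fx] := eqVneq (f x) 0.
      rewrite mul0r normr0 !mulr_ge0//; first exact: le_trans (fM 0).
      exact: le_trans (kc n 0).
    rewrite !normrM ler_pM ?mulr_ge0 ?normr_ge0// ler_pM ?normr_ge0//.
    exact: le_trans (ler_coord_enorm _ _) (le_trans fx (ler_norm _)).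
have E n : integral_rV setT (fun x => f x * (x ord0 j * k n x)) =
    integral_rV setT (fun x => 2^-1 * (f x - f (- x)) * (x ord0 j * k n x)).
  have mI := integrable_rV_measurable (ik n).
  set I := LHS.
  have -> : I = 2^-1 * I + 2^-1 * integral_rV setT (fun x => f (- x) * ((- x)
    ord0 j * k n (- x))).
    by rewrite (integral_rV_opp mI) -/I; field.
  have iN : integrable_rV (fun x => f (- x) * ((- x) ord0 j * k n (- x))).
    apply: (@integrable_rV_bounded_ball `|rho| (M * (`|rho| * c n))).
    - exact: measurable_rV_opp mI.
    - move=> x; rewrite mulf_eq0 negb_or => /andP[/sf h _].
      by rewrite enormN in h; exact: le_trans (ler_norm _).
    - move=> x; have [->|/sf fx] := eqVneq (f (- x)) 0.
        rewrite mul0r normr0 !mulr_ge0//; first exact: le_trans (fM 0).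
        exact: le_trans (kc n 0).
      rewrite !normrM ler_pM ?mulr_ge0 ?normr_ge0// ler_pM ?normr_ge0//.
      exact: le_trans (ler_coord_enorm _ _) (le_trans fx (ler_norm _)).
  rewrite -!integral_rVZl// -integral_rVD; try exact: integrable_rVZl.
  by congr integral_rV; apply/funext => x; rewrite ke mxE; ring.
under eq_fun do rewrite E.
apply: (@cvg_integral_rV _ _ _ _ (fun x =>
  L * (ball_ind rho x * (enorm x ^+ 2 / enorm x ^+ m.+1)))).
- by move=> n; exact: measurable_odd_kernel.
- move=> x; have [->|x0] := eqVneq x 0.
    by rewrite mxE mul0r mulr0; under eq_fun do rewrite mul0r mulr0;
      exact: cvg_cst.
  by apply: cvgM; [exact: cvg_cst|apply: cvgM; [exact: cvg_cst|exact: kl]].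
- by apply: (integrable_rVZl L); exact: (integrable_weight m rho).
- by move=> n x; apply: odd_kernel_bound => // x0; exact: kb.
Qed.

End OddPairing.
End Kernel.

(** * Monogenicity of the Cauchy kernel *)

Section DifferentialCalculus.
Variables (R : realType).

Lemma is_derive_linear_fun (V : normedModType R) (f : V -> R) (x v : V) :
  (forall h u w, f (h *: u + w) = h * f u + f w) -> is_derive x v f (f v).
Proof.
move=> lf.
have h : (fun h => h^-1 *: ((f \o shift x) (h *: v) - f x)) h @[h --> 0^'] -->
  f v.
  apply: cvg_near_cst; near=> h.
  rewrite /= lf addrK /GRing.scale /= mulrA mulVf ?mul1r//.
  by near: h; exact: nbhs_dnbhs_neq.
apply: DeriveDef; first by apply/cvg_ex; exists (f v).
exact: cvg_lim h.
Unshelve. all: by end_near. Qed.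

Lemma is_derive_comp_real (V : normedModType R) (f : V -> R) (g : R -> R)
    (x v : V) (df dg : R) : differentiable f x -> is_derive x v f df ->
  is_derive (f x) 1 g dg -> is_derive x v (g \o f) (dg * df).
Proof.
move=> f1 f2 g1.
have dg1 : differentiable g (f x) by apply/derivable1_diffP; exact: ex_derive.
have dgf : differentiable (g \o f) x by exact: differentiable_comp.
apply: DeriveDef; first exact: diff_derivable.
have E : 'd f x v = df by rewrite -deriveE// derive_val.
rewrite deriveE// diff_comp// /comp E diff1E//.
by rewrite derive1E derive_val /GRing.scale /= mulrC.
Qed.

End DifferentialCalculus.

(** * Vectors and conjugates in the Clifford algebra *)

Section CliffordVectors.
Variables (R : realType) (m : nat).
Local Notation Cl := (clifford R m.+1).
Local Notation pt := (R * 'rV[R]_m)%type.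
Local Notation e0 := (@e0 R m).
Local Notation e0bar := (@e0bar R m).
Local Notation ej := (@ej R m).

Lemma cl_coefB A (a b : Cl) : cl_coef A (a - b) = cl_coef A a - cl_coef A b.
Proof. by rewrite -scaleN1r cl_coefD cl_coefZ mulN1r. Qed.

Lemma cl_gen_sqr (i : 'I_m.+1) : cl_gen R i * cl_gen R i = -1.
Proof.
have := cl_gen_anticomm R i i; rewrite eqxx -mulr2n -mulNrn.
rewrite -[LHS]scaler_nat -[RHS]scaler_nat; apply: scalerI.
by rewrite pnatr_eq0.
Qed.

Lemma e0_sqr : e0 * e0 = -1. Proof. exact: cl_gen_sqr. Qed.

Lemma e0_e0bar : e0 * e0bar = 1.
Proof. by rewrite /e0bar mulrN e0_sqr opprK. Qed.

Lemma cl_vec_e0 (x : 'rV[R]_m) : cl_vec x * e0 = - (e0 * cl_vec x).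
Proof.
rewrite /cl_vec mulr_suml mulr_sumr -sumrN; apply: eq_bigr => j _.
rewrite -cl_scaleAl -cl_scaleAr -scalerN; congr (_ *: _).
apply/eqP; rewrite -addr_eq0; apply/eqP.
have := cl_gen_anticomm R (lift ord0 j) (ord0 : 'I_m.+1).
by rewrite eq_sym (negbTE (neq_lift _ _)) mul0rn oppr0.
Qed.

Lemma cl_vec_sqr (x : 'rV[R]_m) : cl_vec x * cl_vec x = - (enorm x ^+ 2)%:A.
Proof.
(* Doubling symmetrises the double sum over basis vectors, so that anticommutation removes every
   off-diagonal term. *)
suff : cl_vec x * cl_vec x + cl_vec x * cl_vec x = - (enorm x ^+ 2)%:A *+ 2.
  rewrite -mulr2n -[LHS]scaler_nat -[RHS]scaler_nat; apply: scalerI.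
  by rewrite pnatr_eq0.
have E : cl_vec x * cl_vec x =
    \sum_i \sum_j (x ord0 i * x ord0 j) *: (ej i * ej j).
  rewrite /cl_vec mulr_suml; apply: eq_bigr => i _.
  rewrite mulr_sumr; apply: eq_bigr => j _.
  by rewrite -cl_scaleAl -cl_scaleAr scalerA.
rewrite {1}E {}E [X in _ + X]exchange_big -big_split /=.
rewrite enorm_sqr scaler_suml -sumrN -sumrMnl; apply: eq_bigr => i _.
rewrite -big_split /= (bigD1 i)//= big1 ?addr0.
  rewrite -scalerDr cl_gen_anticomm eqxx -expr2 scalerN mulNrn; congr (- _).
  by rewrite scalerMnr.
move=> j ji; rewrite [X in X *: (ej j * _)]mulrC -scalerDr cl_gen_anticomm.
rewrite (inj_eq lift_inj) eq_sym (negbTE ji) mul0rn oppr0 scaler0//.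
Qed.

Definition cl_conj (p : pt) : Cl := p.1%:A - e0bar * cl_vec p.2.

(** Linearity makes [cl_conj v] the derivative of [cl_conj] along [v], so the numerator of the
    kernel is differentiated by evaluation. *)
Lemma cl_conj_linear (h : R) (p q : pt) :
  cl_conj (h *: p + q) = h *: cl_conj p + cl_conj q.
Proof.
rewrite /cl_conj /= scalerDl -scalerA scalerBr.
have -> : cl_vec (h *: p.2 + q.2) = h *: cl_vec p.2 + cl_vec q.2.
  rewrite /cl_vec scaler_sumr -big_split; apply: eq_bigr => j _ /=.
  by rewrite !mxE scalerDl scalerA.
by rewrite mulrDr -cl_scaleAr opprD addrACA.
Qed.

Lemma cl_conj_dir0 : cl_conj (dir0 R m) = 1.
Proof.
rewrite /cl_conj /dir0 /= scale1r (_ : cl_vec 0 = 0) ?mulr0 ?subr0//.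
by rewrite /cl_vec big1// => j _; rewrite mxE scale0r.
Qed.

Lemma cl_conj_dirj j : cl_conj (dirj R j) = - (e0bar * ej j).
Proof.
rewrite /cl_conj /dirj /= scale0r sub0r /cl_vec (bigD1 j)//= big1 ?addr0.
  by rewrite mxE !eqxx scale1r.
by move=> i ij; rewrite mxE eqxx (negbTE ij) scale0r.
Qed.

Lemma e0bar_cl_vecE (x : 'rV[R]_m) :
  e0bar * cl_vec x = \sum_j x ord0 j *: (e0bar * ej j).
Proof.
rewrite /cl_vec mulr_sumr; apply: eq_bigr => j _.
by rewrite -cl_scaleAr.
Qed.

Lemma e0bar_cl_vec_sqr (x : 'rV[R]_m) :
  (e0bar * cl_vec x) * (e0bar * cl_vec x) = - (enorm x ^+ 2)%:A.
Proof.
rewrite /e0bar !mulNr mulrN opprK mulrA -[e0 * _ * e0]mulrA cl_vec_e0.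
by rewrite mulrN mulNr mulrA e0_sqr mulN1r mulNr opprK cl_vec_sqr.
Qed.

Lemma e0bar_ej_sqr j : (e0bar * ej j) * (e0bar * ej j) = -1.
Proof.
have -> : ej j = cl_vec (delta_mx ord0 j).
  rewrite /cl_vec (bigD1 j)//= big1 ?addr0; first by rewrite mxE !eqxx scale1r.
  by move=> i ij; rewrite mxE eqxx (negbTE ij) scale0r.
rewrite e0bar_cl_vec_sqr enorm_sqr (bigD1 j)//= big1.
  by rewrite mxE !eqxx expr1n addr0 scale1r.
by move=> i ij; rewrite mxE eqxx (negbTE ij) expr0n.
Qed.

Lemma pnorm_sqr (p : pt) : pnorm p ^+ 2 = p.1 ^+ 2 + enorm p.2 ^+ 2.
Proof. by rewrite sqr_sqrtr// addr_ge0// sqr_ge0. Qed.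

Lemma cl_conj_mulr (p : pt) :
  cl_conj p * (p.1%:A + e0bar * cl_vec p.2) = (pnorm p ^+ 2)%:A.
Proof.
rewrite /cl_conj mulrDr mulrBl mulrBl -!cl_scaleAl -!cl_scaleAr !mul1r !mulr1.
rewrite e0bar_cl_vec_sqr pnorm_sqr scalerDl opprK scalerA -expr2.
by rewrite addrA subrK.
Qed.

Lemma cl_conj_mull (p : pt) :
  (p.1%:A + e0bar * cl_vec p.2) * cl_conj p = (pnorm p ^+ 2)%:A.
Proof.
rewrite /cl_conj mulrBr mulrDl mulrDl -!cl_scaleAl -!cl_scaleAr !mul1r !mulr1.
rewrite e0bar_cl_vec_sqr pnorm_sqr scalerDl opprD opprK scalerA -expr2.
by rewrite addrA addrK.
Qed.

Lemma cauchy_kernelE (p : pt) : cauchy_kernel p =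
  (sphere_area R m.+1)^-1 *: ((pnorm p ^+ m.+1)^-1 *: cl_conj p).
Proof. by []. Qed.

End CliffordVectors.

(** * Derivatives of the Cauchy kernel *)

Section KernelDerivatives.
Variables (R : realType) (m : nat).
Local Notation Cl := (clifford R m.+1).
Local Notation pt := (R * 'rV[R]_m)%type.
Local Notation e0 := (@e0 R m).
Local Notation e0bar := (@e0bar R m).
Local Notation ej := (@ej R m).

Definition pdot (p v : pt) : R := p.1 * v.1 + \sum_j p.2 ord0 j * v.2 ord0 j.

Lemma differentiable_fctX (f : pt -> R) k p : differentiable f p ->
  differentiable (fun q => f q ^+ k) p.
Proof.
move=> df; elim: k => [|k IHk].
  by under eq_fun do rewrite expr0; exact: differentiable_cst.
by under eq_fun do rewrite exprS; exact: differentiableM.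
Qed.

Lemma differentiable_fst_pt (p : pt) : differentiable (fst : pt -> R) p.
Proof. by apply: linear_differentiable => q; exact: cvg_fst. Qed.

Lemma differentiable_coord_pt j (p : pt) :
  differentiable (fun q : pt => q.2 ord0 j) p.
Proof.
apply: (@differentiable_comp _ _ _ _ (snd : pt -> 'rV[R]_m) (fun z : 'rV[R]_m
  => z ord0 j)).
  by apply: linear_differentiable => q; exact: cvg_snd.
exact: differentiable_coord.
Qed.

Local Notation sqnorm_pt :=
  (fun q : pt => q.1 ^+ 2 + \sum_j q.2 ord0 j ^+ 2).

Lemma differentiable_sqnorm (p : pt) :
  differentiable sqnorm_pt p.
Proof.
apply: differentiableD; first exact/differentiable_fctX/differentiable_fst_pt.
rewrite (_ : (fun _ => _) = \sum_(j < m) (fun q : pt => q.2 ord0 j ^+ 2));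
  last first.
  by apply/funext => q; rewrite fct_sumE.
apply: differentiable_sum => j;
  exact: (differentiable_fctX 2 (differentiable_coord_pt j p)).
Qed.

Lemma differentiable_pdot v (p : pt) : differentiable (pdot ^~ v) p.
Proof.
apply: differentiableD.
  by apply: differentiableM;
    [exact: differentiable_fst_pt|exact: differentiable_cst].
rewrite (_ : (fun _ => _) = \sum_(j < m) (fun q : pt => q.2 ord0 j * v.2 ord0
  j)); last first.
  by apply/funext => q; rewrite fct_sumE.
apply: differentiable_sum => j.
by apply: differentiableM;
  [exact: differentiable_coord_pt|exact: differentiable_cst].
Qed.

Lemma pnormE (p : pt) : pnorm p = Num.sqrt (p.1 ^+ 2 + \sum_j p.2 ord0 j ^+ 2).
Proof. by rewrite /pnorm enorm_sqr. Qed.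

Lemma differentiable_pnorm (p : pt) : 0 < pnorm p -> differentiable (@pnorm R
  m) p.
Proof.
move=> p0; rewrite (_ : @pnorm R m = Num.sqrt \o sqnorm_pt); last first.
  by apply/funext => q; rewrite pnormE.
apply: differentiable_comp; first exact: differentiable_sqnorm.
apply/derivable1_diffP; apply: ex_derive; apply: is_derive1_sqrt.
by rewrite -sqrtr_gt0 -pnormE.
Qed.

Lemma is_derive_pnorm (p v : pt) : 0 < pnorm p ->
  is_derive p v (@pnorm R m) (pdot p v / pnorm p).
Proof.
move=> p0; rewrite (_ : @pnorm R m = Num.sqrt \o sqnorm_pt); last first.
  by apply/funext => q; rewrite pnormE.
have dN : is_derive p v sqnorm_pt (2 * pdot p v).
  have d1 : is_derive p v (fst : pt -> R) v.1 by apply: is_derive_linear_fun.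
  have d2 j : is_derive p v (fun q : pt => q.2 ord0 j) (v.2 ord0 j).
    by apply: (@is_derive_linear_fun _ _ (fun q : pt => q.2 ord0 j)) => h u w;
      rewrite /= !mxE.
  have := is_deriveD (is_deriveX 2 d1) (is_derive_sum (fun j => is_deriveX 2
    (d2 j))).
  rewrite (_ : _ + _ = sqnorm_pt); last first.
    by apply/funext => q; rewrite /= fctE fct_sumE.
  move=> H; apply: is_derive_eq H _.
  rewrite /pdot mulrDr mulr_sumr; congr (_ + _);
    first by rewrite /GRing.scale /= expr1 mulrA.
  by apply: eq_bigr => j _; rewrite /GRing.scale /= expr1 mulrA.
have N0 : 0 < p.1 ^+ 2 + \sum_j p.2 ord0 j ^+ 2 by rewrite -sqrtr_gt0 -pnormE.
have := is_derive_comp_real (differentiable_sqnorm p) dN (is_derive1_sqrt N0).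
move=> H; apply: is_derive_eq H _.
by rewrite [in RHS]/= -!pnormE; field; rewrite gt_eqF.
Qed.

Variables (a : Cl) (A : {set 'I_m.+1}).

(** Keeping a constant left factor [a] treats the kernel itself and its multiples by [e0] and
    [e0bar] together. *)
Let l (p : pt) : R := cl_coef A (a * cl_conj p).

Lemma cl_coef_conj_linear h (p q : pt) : l (h *: p + q) = h * l p + l q.
Proof. by rewrite /l cl_conj_linear mulrDr -cl_scaleAr cl_coefD cl_coefZ. Qed.

Lemma cl_coef_conjE (p : pt) : l p =
  p.1 * cl_coef A a - \sum_j p.2 ord0 j * cl_coef A (a * (e0bar * ej j)).
Proof.
rewrite /l /cl_conj mulrBr -cl_scaleAr mulr1 e0bar_cl_vecE mulr_sumr.
rewrite -scaleN1r cl_coefD !cl_coefZ cl_coef_sum mulN1r; congr (_ - _).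
by apply: eq_bigr => j _; rewrite -cl_scaleAr cl_coefZ.
Qed.

Lemma differentiable_cl_coef_conj (p : pt) : differentiable l p.
Proof.
rewrite (_ : l = (fun p : pt => p.1 * cl_coef A a -
    \sum_j p.2 ord0 j * cl_coef A (a * (e0bar * ej j)))); last first.
  by apply/funext => q; exact: cl_coef_conjE.
apply: differentiableB.
  by apply: differentiableM;
    [exact: differentiable_fst_pt|exact: differentiable_cst].
rewrite (_ : (fun _ => _) = \sum_(j < m) (fun q : pt => q.2 ord0 j * cl_coef A
  (a * (e0bar * ej j)))); last first.
  by apply/funext => q; rewrite fct_sumE.
apply: differentiable_sum => j.
by apply: differentiableM;
  [exact: differentiable_coord_pt|exact: differentiable_cst].
Qed.

Lemma cl_coef_kernel (p : pt) : cl_coef A (a * cauchy_kernel p) =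
  (sphere_area R m.+1)^-1 * ((pnorm p ^+ m.+1)^-1 * l p).
Proof. by rewrite cauchy_kernelE -!cl_scaleAr !cl_coefZ. Qed.

(** The product rule: [l] is its own derivative, being linear, and the power of the norm contributes
    -(m+1) |p|^(-m-2) times the derivative <p, v> / |p| of the norm, whence the exponent m+3. *)
Definition kernel_derivative (v p : pt) : R :=
  (sphere_area R m.+1)^-1 *
    ((pnorm p ^+ m.+1)^-1 * l v - m.+1%:R * pdot p v / pnorm p ^+ m.+3 * l p).

Lemma differentiable_pnormXV k (p : pt) : 0 < pnorm p ->
  differentiable (fun q : pt => (pnorm q ^+ k)^-1) p.
Proof.
move=> p0; apply: differentiableV; last by rewrite expf_neq0// gt_eqF.
by apply: differentiable_fctX; exact: differentiable_pnorm.
Qed.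

Lemma differentiable_kernel (p : pt) : 0 < pnorm p ->
  differentiable (cl_coef A \o (fun q => a * cauchy_kernel q)) p.
Proof.
move=> p0.
rewrite (_ : _ \o _ = (fun q : pt => (sphere_area R m.+1)^-1 * ((pnorm q ^+
  m.+1)^-1 * l q))); last first.
  by apply/funext => q; rewrite /= cl_coef_kernel.
apply: differentiableM; first exact: differentiable_cst.
apply: differentiableM; first exact: differentiable_pnormXV.
exact: differentiable_cl_coef_conj.
Qed.

Lemma is_derive_kernel (v p : pt) : 0 < pnorm p ->
  is_derive p v (cl_coef A \o (fun q => a * cauchy_kernel q))
    (kernel_derivative v p).
Proof.
move=> p0.
rewrite (_ : _ \o _ = (fun q : pt => (sphere_area R m.+1)^-1 * ((pnorm q ^+
  m.+1)^-1 * l q))); last first.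
  by apply/funext => q; rewrite /= cl_coef_kernel.
have dq : is_derive p v (fun q : pt => (pnorm q ^+ m.+1)^-1)
    (- (m.+1%:R * pdot p v / pnorm p ^+ m.+3)).
  have H1 := is_deriveX m.+1 (is_derive_pnorm v p0).
  have H0 : (@pnorm R m ^+ m.+1) p != 0 by rewrite fctE expf_neq0// gt_eqF.
  apply: DeriveDef; first exact/diff_derivable/differentiable_pnormXV.
  rewrite (_ : (fun _ => _) = (fun q => ((@pnorm R m ^+ m.+1) q)^-1));
    last first.
    by apply/funext => q; rewrite fctE.
  rewrite (deriveV H0)// derive_val fctE /GRing.scale /=.
  have p1 : pnorm p != 0 by rewrite gt_eqF.
  by rewrite !exprS; field; rewrite ?expf_neq0 ?p1.
have dl : is_derive p v l (l v) by apply: is_derive_linear_fun;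
  exact: cl_coef_conj_linear.
have := is_deriveM (is_derive_cst (sphere_area R m.+1)^-1 p v) (is_deriveM dq
  dl).
move=> H; apply: is_derive_eq H _.
by rewrite /kernel_derivative /GRing.scale /= mulr0 addr0; congr (_ * _);
  rewrite mulrN [l p * _]mulrC.
Qed.

Lemma continuous_kernel_derivative (v p : pt) : 0 < pnorm p ->
  {for p, continuous (kernel_derivative v)}.
Proof.
move=> p0; apply: differentiable_continuous.
apply: differentiableM; first exact: differentiable_cst.
apply: differentiableB.
  by apply: differentiableM;
    [exact: differentiable_pnormXV|exact: differentiable_cst].
apply: differentiableM; last exact: differentiable_cl_coef_conj.
apply: differentiableM; last exact: differentiable_pnormXV.
by apply: differentiableM;
  [exact: differentiable_cst|exact: differentiable_pdot].
Qed.

End KernelDerivatives.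

(** * Left and right monogenicity *)

Section Monogenic.
Variables (R : realType) (m : nat).
Local Notation Cl := (clifford R m.+1).
Local Notation pt := (R * 'rV[R]_m)%type.
Local Notation e0 := (@e0 R m).
Local Notation e0bar := (@e0bar R m).
Local Notation ej := (@ej R m).

Lemma cl_partial_kernel (a : Cl) (v p : pt) : 0 < pnorm p ->
  cl_partial v (fun q => a * cauchy_kernel q) p =
  (sphere_area R m.+1)^-1 *:
    (a * ((pnorm p ^+ m.+1)^-1 *: cl_conj v -
          (m.+1%:R * pdot p v / pnorm p ^+ m.+3) *: cl_conj p)).
Proof.
move=> p0; apply: cl_coefP => A.
have H := is_derive_kernel a A v p0.
rewrite [LHS]/cl_coef ffunE derive_val cl_coefZ; congr (_ * _).
have -> (k l : R) (x y : Cl) : a * (k *: x - l *: y) = k *: (a * x) - l *: (a *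
  y).
  by rewrite mulrBr -!cl_scaleAr.
by rewrite cl_coefB !cl_coefZ.
Qed.

Lemma pdot_dir0 (p : pt) : pdot p (dir0 R m) = p.1.
Proof. by rewrite /pdot /= mulr1 big1 ?addr0// => j _; rewrite mxE mulr0. Qed.

Lemma pdot_dirj (p : pt) j : pdot p (dirj R j) = p.2 ord0 j.
Proof.
rewrite /pdot /= mulr0 add0r (bigD1 j)//= big1 ?addr0.
  by rewrite mxE !eqxx mulr1.
by move=> i ij; rewrite mxE eqxx (negbTE ij) mulr0.
Qed.

(** Differentiating the numerator gives 1 for x_0 and -(e_j')^2 = 1 for each j, in total (m+1) /
    |p|^(m+1). The derivatives of the norm recombine into (m+1) / |p|^(m+3) times (x_0 - x') (x_0 +
    x'), and the two cancel. The operator multiplies from the right, so [a] factors out. *)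
Lemma cl_Dr_kernel (a : Cl) (p : pt) : 0 < pnorm p ->
  cl_Dr (fun q => a * cauchy_kernel q) p = 0.
Proof.
move=> p0; rewrite /cl_Dr !cl_partial_kernel// cl_conj_dir0 pdot_dir0.
have -> : \sum_j cl_partial (dirj R j) (fun q => a * cauchy_kernel q) p *
  (e0bar * ej j) =
    (sphere_area R m.+1)^-1 *: (a * ((m%:R / pnorm p ^+ m.+1)%:A -
      (m.+1%:R / pnorm p ^+ m.+3) *: (cl_conj p * (e0bar * cl_vec p.2)))).
  under eq_bigr => j _ do rewrite cl_partial_kernel// cl_conj_dirj pdot_dirj
    -cl_scaleAl -mulrA mulrBl -!cl_scaleAl mulNr e0bar_ej_sqr opprK.
  rewrite -scaler_sumr -mulr_sumr sumrB sumr_const card_ord;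
    congr (_ *: (_ * (_ - _))).
    by rewrite -[LHS]scaler_nat scalerA.
  rewrite e0bar_cl_vecE mulr_sumr scaler_sumr; apply: eq_bigr => j _.
  by rewrite -cl_scaleAr scalerA mulrAC.
rewrite -scalerDr -mulrDr.
suff -> : (pnorm p ^+ m.+1)^-1 *: 1 - (m.+1%:R * p.1 / pnorm p ^+ m.+3) *:
  cl_conj p +
    ((m%:R / pnorm p ^+ m.+1)%:A - (m.+1%:R / pnorm p ^+ m.+3) *: (cl_conj p *
      (e0bar * cl_vec p.2))) = 0 :> Cl.
  by rewrite mulr0 !scaler0.
rewrite addrACA -scalerDl -opprD.
have -> : (m.+1%:R * p.1 / pnorm p ^+ m.+3) *: cl_conj p +
    (m.+1%:R / pnorm p ^+ m.+3) *: (cl_conj p * (e0bar * cl_vec p.2)) =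
    (m.+1%:R / pnorm p ^+ m.+3 * pnorm p ^+ 2)%:A.
  rewrite -[RHS]scalerA -cl_conj_mulr mulrDr -cl_scaleAr mulr1.
  by rewrite [RHS]scalerDr [in RHS]scalerA mulrAC.
apply/eqP; rewrite subr_eq0; apply/eqP; congr (_ *: _).
have p1 : pnorm p != 0 by rewrite gt_eqF.
by rewrite -[m.+1%:R]natr1 !exprS; field; rewrite ?expf_neq0 ?p1.
Qed.

(** The same cancellation with the product in the order (x_0 + x') (x_0 - x'). The left factor is
    now 1: a general one would stand between the e_j' and the kernel and need not commute with
    them. *)
Lemma cl_D_kernel (p : pt) : 0 < pnorm p -> cl_D (@cauchy_kernel R m) p = 0.
Proof.
move=> p0; rewrite /cl_D.
have E : @cauchy_kernel R m = (fun q => 1 * cauchy_kernel q).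
  by apply/funext => q; rewrite mul1r.
rewrite E !cl_partial_kernel// cl_conj_dir0 pdot_dir0 mul1r.
have -> : e0bar * (\sum_j ej j * cl_partial (dirj R j) (fun q => 1 *
  cauchy_kernel q) p) =
    (sphere_area R m.+1)^-1 *: ((m%:R / pnorm p ^+ m.+1)%:A -
      (m.+1%:R / pnorm p ^+ m.+3) *: ((e0bar * cl_vec p.2) * cl_conj p)).
  rewrite mulr_sumr.
  under eq_bigr => j _ do rewrite cl_partial_kernel// cl_conj_dirj pdot_dirj
    mul1r
    mulrA -cl_scaleAr mulrBr -!cl_scaleAr mulrN e0bar_ej_sqr opprK.
  rewrite -scaler_sumr sumrB sumr_const card_ord; congr (_ *: (_ - _)).
    by rewrite -[LHS]scaler_nat scalerA.
  rewrite e0bar_cl_vecE mulr_suml scaler_sumr; apply: eq_bigr => j _.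
  by rewrite -cl_scaleAl scalerA mulrAC.
rewrite -scalerDr.
suff -> : (pnorm p ^+ m.+1)^-1 *: 1 - (m.+1%:R * p.1 / pnorm p ^+ m.+3) *:
  cl_conj p +
    ((m%:R / pnorm p ^+ m.+1)%:A - (m.+1%:R / pnorm p ^+ m.+3) *: ((e0bar *
      cl_vec p.2) * cl_conj p)) = 0 :> Cl.
  by rewrite !scaler0.
rewrite addrACA -scalerDl -opprD.
have -> : (m.+1%:R * p.1 / pnorm p ^+ m.+3) *: cl_conj p +
    (m.+1%:R / pnorm p ^+ m.+3) *: ((e0bar * cl_vec p.2) * cl_conj p) =
    (m.+1%:R / pnorm p ^+ m.+3 * pnorm p ^+ 2)%:A.
  rewrite -[RHS]scalerA -cl_conj_mull mulrDl -cl_scaleAl mul1r.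
  by rewrite [RHS]scalerDr [in RHS]scalerA mulrAC.
apply/eqP; rewrite subr_eq0; apply/eqP; congr (_ *: _).
have p1 : pnorm p != 0 by rewrite gt_eqF.
by rewrite -[m.+1%:R]natr1 !exprS; field; rewrite ?expf_neq0 ?p1.
Qed.

Lemma C1_on_kernel (U : set pt) (a : Cl) : (forall p, U p -> 0 < pnorm p) ->
  C1_on U (fun q => a * cauchy_kernel q).
Proof.
move=> Up A p /Up p0; split; first exact: differentiable_kernel.
move=> v; have pc : {for p, continuous (@pnorm R m)}.
  exact/differentiable_continuous/differentiable_pnorm.
(* Continuity of the derivative at [p] requires its formula on a whole neighbourhood, where the norm
   stays positive. *)
have near_p : \forall q \near p, 0 < pnorm q by exact: (cvgr_gt _ pc).
rewrite /continuous_at /prop_for.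
have -> : 'D_v (cl_coef A \o (fun q => a * cauchy_kernel q)) p =
  kernel_derivative a A v p.
  by have H := is_derive_kernel a A v p0; rewrite derive_val.
have C : kernel_derivative a A v q @[q --> p] --> kernel_derivative a A v p.
  exact: continuous_kernel_derivative.
move: C; apply: cvg_trans; apply: near_eq_cvg; near=> q.
have q0 : 0 < pnorm q by near: q.
by have H := is_derive_kernel a A v q0; rewrite derive_val.
Unshelve. all: by end_near. Qed.

Lemma pnorm_upper_half (p : pt) : upper_half p -> 0 < pnorm p.
Proof. by rewrite /upper_half /= => p0;
  rewrite sqrtr_gt0 ltr_pwDl ?sqr_ge0// exprn_gt0. Qed.

Lemma pnorm_lower_half (p : pt) : lower_half p -> 0 < pnorm p.
Proof.
rewrite /lower_half /= => p0; rewrite sqrtr_gt0 ltr_pwDl ?sqr_ge0//.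
by rewrite exprn_even_gt0//= lt_eqF.
Qed.

Lemma right_monogenic_kernel (U : set pt) (a : Cl) :
  (forall p, U p -> 0 < pnorm p) ->
  right_monogenic U (fun q => a * cauchy_kernel q).
Proof.
move=> Up; split; first exact: C1_on_kernel.
by move=> p /Up p0; exact: cl_Dr_kernel.
Qed.

Lemma left_monogenic_kernel (U : set pt) :
  (forall p, U p -> 0 < pnorm p) -> left_monogenic U (@cauchy_kernel R m).
Proof.
move=> Up; split; last by move=> p /Up p0; exact: cl_D_kernel.
rewrite (_ : @cauchy_kernel R m = (fun q => 1 * cauchy_kernel q)).
  exact: C1_on_kernel.
by apply/funext => q; rewrite mul1r.
Qed.

End Monogenic.

(** * Boundary values in the sense of distributions *)

Section Distributions.
Variables (R : realType) (m : nat).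
Local Notation Cl := (clifford R m.+1).
Local Notation e0 := (@e0 R m).
Local Notation e0bar := (@e0bar R m).
Local Notation ej := (@ej R m).
Implicit Types (f g : 'rV[R]_m -> R).

Lemma iter_partial_linear (c : R) f g s : smooth f -> smooth g ->
  iter_partial s (fun x => c * f x + g x) =
  (fun x => c * iter_partial s f x + iter_partial s g x).
Proof.
move=> sf sg; elim: s => [//|j s IHs] /=.
rewrite IHs; apply/funext => x.
have df : derivable (iter_partial s f) x (delta_mx ord0 j) by
  exact/diff_derivable/sf.
have dg : derivable (iter_partial s g) x (delta_mx ord0 j) by
  exact/diff_derivable/sg.
rewrite (_ : (fun _ => _) = c *: iter_partial s f + iter_partial s g).
  have dcf : derivable (c *: iter_partial s f) x (delta_mx ord0 j) by exact:
    derivableZ.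
  by rewrite (deriveD dcf dg) deriveZ.
by apply/funext.
Qed.

Lemma test_function_linear (c : R) f g : test_function f -> test_function g ->
  test_function (fun x => c * f x + g x).
Proof.
move=> [sf cf] [sg cg]; split.
  move=> s x; rewrite iter_partial_linear//.
  apply: differentiableD; last exact: sg.
  by apply: differentiableM; [exact: differentiable_cst|exact: sf].
apply: (@subclosed_compact _ _ (tsupport f `|` tsupport g)).
- exact: closed_closure.
- exact: compactU.
rewrite /tsupport -closureU; apply: closure_subset => x /= h.
have [fx|fx] := eqVneq (f x) 0; last by left.
by right; move: h; rewrite fx mulr0 add0r.
Qed.

Definition scalar_distribution (phi : ('rV[R]_m -> R) -> R) : Prop :=
  (forall (c : R) f g, test_function f -> test_function g ->
     phi (fun x => c * f x + g x) = c * phi f + phi g) /\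
  (forall K : set 'rV[R]_m, compact K ->
     exists (c : R) (N : nat), forall f, test_function f -> tsupport f `<=` K ->
       forall B : R,
         (forall s x, (size s <= N)%N -> `|iter_partial s f x| <= B) ->
         `|phi f| <= c * B).

Lemma is_distribution_scale phi (a : Cl) : scalar_distribution phi ->
  is_distribution (fun f => phi f *: a).
Proof.
move=> [lphi bphi]; split.
  by move=> c f g tf tg; rewrite lphi// scalerDl scalerA.
move=> K cK; have [c [N H]] := bphi K cK.
(* A single constant has to serve all coefficients, hence the sum over [A]. *)
exists (c * \sum_A `|cl_coef A a|), N => f tf fK B fB A.
have h := H f tf fK B fB.
rewrite cl_coefZ normrM mulrAC ler_pM//.
by rewrite (bigD1 A)//= lerDl sumr_ge0.
Qed.

Lemma is_distributionD (T S : functional R m) :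
  is_distribution T -> is_distribution S -> is_distribution (fun f => T f + S
    f).
Proof.
move=> [lT bT] [lS bS]; split.
  by move=> c f g tf tg; rewrite lT// lS// scalerDr addrACA.
move=> K cK; have [c1 [N1 H1]] := bT K cK; have [c2 [N2 H2]] := bS K cK.
exists (c1 + c2), (maxn N1 N2) => f tf fK B fB A.
rewrite cl_coefD (le_trans (ler_normD _ _))// mulrDl lerD//.
  by apply: H1 => // s x sN; apply: fB; rewrite leq_max sN.
by apply: H2 => // s x sN; apply: fB; rewrite leq_max sN orbT.
Qed.

Lemma is_distribution_sum (I : Type) (s : seq I) (T : I -> functional R m) :
  (forall i, is_distribution (T i)) -> is_distribution (fun f => \sum_(i <- s)
    T i f).
Proof.
move=> dT; elim: s => [|i s IHs].
  under eq_fun do rewrite big_nil.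
  split; first by move=> *; rewrite scaler0 addr0.
  by move=> K _; exists 0, 0%N => f _ _ B _ A; rewrite cl_coef0 normr0 mul0r.
by under eq_fun do rewrite big_cons; exact: is_distributionD.
Qed.

Lemma is_distribution_eq (T S : functional R m) :
  eq_distribution T S -> is_distribution S -> is_distribution T.
Proof.
move=> TS [lS bS]; split.
  by move=> c f g tf tg; rewrite !TS ?lS//; exact: test_function_linear.
move=> K cK; have [c [N H]] := bS K cK.
by exists c, N => f tf fK B fB A; rewrite TS//; exact: H fK B fB A.
Qed.

Lemma scalar_distribution_eval0 : scalar_distribution (fun f => f 0).
Proof.
split=> // K _; exists 1, 0%N => f _ _ B fB.
by rewrite mul1r; apply: (fB [::]).
Qed.

Lemma test_function_odd_bound f rho : test_function f ->
  exists L, 0 <= L /\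
    forall x, enorm x <= rho -> `|2^-1 * (f x - f (- x))| <= L * enorm x.
Proof.
move=> [sf _]; have [B [B0 HB]] := differentiable_partials_bounded rho sf.
exists (m%:R * B); split; first by rewrite mulr_ge0.
move=> x xrho; apply: odd_part_bound; first exact: (sf [::]).
by move=> j y yx; apply: HB; exact: le_trans yx xrho.
Qed.

Lemma test_function_integrable_odd_pairing f j : test_function f ->
  integrable_rV (fun x => 2^-1 * (f x - f (- x)) * (x ord0 j / enorm x ^+
    m.+1)).
Proof.
move=> tf; have [rho [_ sf]] := test_function_supported tf.
have [L [L0 HL]] := test_function_odd_bound rho tf.
exact: (integrable_odd_pairing (test_function_continuous tf) sf HL).
Qed.

(** A distribution of order at most one: the mean value bound on the odd part uses first partial
    derivatives only, and the integral of |x|^(1-m) over a ball containing [K] gives the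
    constant. *)
Lemma scalar_distribution_odd_pairing j : scalar_distribution (odd_pairing j).
Proof.
split=> [c f g tf tg|K cK].
  have [i1 i2] := (test_function_integrable_odd_pairing j tf,
                   test_function_integrable_odd_pairing j tg).
  rewrite /odd_pairing -integral_rVZl// -integral_rVD//;
    last exact: integrable_rVZl.
  by congr integral_rV; apply/funext => x; ring.
have [rho [rho0 Krho]] := compact_enorm_bounded cK.
exists (m%:R * ball_weight m rho), 1%N => f tf fK B fB.
have sf := tsupport_supported fK Krho.
have B0 : 0 <= B by apply: le_trans (normr_ge0 _) (fB [::] 0 _).
rewrite mulrAC; apply: (odd_pairing_bound (test_function_continuous tf) sf).
  move=> x _; apply: odd_part_bound; first exact: (tf.1 [::]).
  by move=> i y _; apply: (fB [:: i]).
by rewrite mulr_ge0.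
Qed.

(** On test functions this is the principal value of the density \underline{\omega} / r^m. *)
Definition odd_functional : functional R m :=
  fun f => \sum_j odd_pairing j f *: ej j.

Lemma e0bar_odd_functional f :
  e0bar * odd_functional f = \sum_j odd_pairing j f *: (e0bar * ej j).
Proof.
by rewrite /odd_functional mulr_sumr; apply: eq_bigr => j _;
  rewrite -cl_scaleAr.
Qed.

Lemma cl_coef_test_integral (F : 'rV[R]_m -> Cl) D A f :
  cl_coef A (cl_integral D (fun x => f x *: F x)) =
  integral_rV D (fun x => f x * cl_coef A (F x)).
Proof.
rewrite [LHS]/cl_coef ffunE; congr integral_rV; apply/funext => x.
by rewrite /= cl_coefZ.
Qed.

(** * Test functions and the principal value *)

Section TestPairing.
Variables (f : 'rV[R]_m -> R).
Hypothesis tf : test_function f.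

Lemma integrable_test_bounded (k : 'rV[R]_m -> R) c : measurable_rV k ->
  (forall x, `|k x| <= c) -> integrable_rV (fun x => f x * k x).
Proof.
move=> mk kc; have [rho [_ sf]] := test_function_supported tf.
have [M fM] := test_function_bounded tf.
apply: (@integrable_rV_bounded_ball _ _ rho (M * c)).
- apply: measurable_funM => //; apply: measurable_rV_continuous.
  exact: test_function_continuous.
- by move=> x; rewrite mulf_eq0 negb_or => /andP[/sf].
- by move=> x; rewrite normrM ler_pM.
Qed.

Lemma integrable_test_coord_bounded (k : 'rV[R]_m -> R) c j : measurable_rV k ->
  (forall x, `|k x| <= c) -> integrable_rV (fun x => f x * (x ord0 j * k x)).
Proof.
move=> mk kc; have [rho [rho0 sf]] := test_function_supported tf.
have [M fM] := test_function_bounded tf.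
apply: (@integrable_rV_bounded_ball _ _ rho (M * (rho * c))).
- apply: measurable_funM.
    by apply: measurable_rV_continuous; exact: test_function_continuous.
  by apply: measurable_funM => //; exact: measurable_rV_coord.
- by move=> x; rewrite mulf_eq0 negb_or => /andP[/sf].
- move=> x; have [->|/sf fx] := eqVneq (f x) 0.
    rewrite mul0r normr0 !mulr_ge0//; first exact: le_trans (fM 0).
    exact: le_trans (kc 0).
  rewrite !normrM ler_pM ?mulr_ge0// ler_pM//.
  exact: le_trans (ler_coord_enorm _ _) fx.
Qed.

Lemma cvg_test_odd_pairing (k : nat -> 'rV[R]_m -> R) (c : nat -> R) j :
  (forall n, measurable_rV (k n)) ->
  (forall n x, k n (- x) = k n x) ->
  (forall n x, `|k n x| <= c n) ->
  (forall n x, x != 0 -> `|k n x| <= (enorm x ^+ m.+1)^-1) ->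
  (forall x, x != 0 -> k n x @[n --> \oo] --> (enorm x ^+ m.+1)^-1) ->
  integral_rV setT (fun x => f x * (x ord0 j * k n x)) @[n --> \oo] -->
    odd_pairing j f.
Proof.
have [rho [_ sf]] := test_function_supported tf.
have [M fM] := test_function_bounded tf.
have [L [L0 HL]] := test_function_odd_bound rho tf.
exact: (cvg_odd_pairing (test_function_continuous tf) sf fM HL).
Qed.

(** The exponent is m+1 because \underline{\omega} / r^m = \underline{x} / r^(m+1). Removing the
    closed ball matches the strict inequality in [Pv_truncated]. *)
Definition truncated_kern (eps : R) (x : 'rV[R]_m) : R :=
  (1 - ball_ind eps x) * (enorm x ^+ m.+1)^-1.

Lemma truncated_kernE eps x : truncated_kern eps x =
  if enorm x <= eps then 0 else (enorm x ^+ m.+1)^-1.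
Proof.
rewrite /truncated_kern /ball_ind.
by case: ifP => _; rewrite ?subrr ?mul0r// subr0 mul1r.
Qed.

Lemma truncated_kern_bounded eps : 0 < eps ->
  forall x, `|truncated_kern eps x| <= (eps ^+ m.+1)^-1.
Proof.
move=> eps0 x; rewrite truncated_kernE; case: (leP (enorm x) eps) => h.
  by rewrite normr0 invr_ge0 exprn_ge0// ltW.
have x0 := lt_trans eps0 h.
rewrite ger0_norm ?invr_ge0 ?exprn_ge0 ?enorm_ge0//.
by rewrite lef_pV2 ?posrE ?exprn_gt0// lerXn2r ?nnegrE ?ltW.
Qed.

Lemma measurable_truncated_kern eps : measurable_rV (truncated_kern eps).
Proof.
apply: measurable_funM; last exact: measurable_enormV.
apply: measurable_funB => //.
exact: measurable_ball_ind.
Qed.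

Lemma cl_coef_Pv_truncated A eps : 0 < eps ->
  cl_coef A (Pv_truncated (@hilbert_density R m) f eps) =
  \sum_j cl_coef A (ej j) *
    integral_rV setT (fun x => f x * (x ord0 j * truncated_kern eps x)).
Proof.
move=> eps0; rewrite /Pv_truncated cl_coef_test_integral integral_rV_mkcond.
have ij j := integrable_test_coord_bounded j (measurable_truncated_kern eps)
  (truncated_kern_bounded eps0).
have E : (fun x => \1_[set x | eps < enorm x] x * (f x * cl_coef A
  (hilbert_density x))) =
    (fun x => \sum_j cl_coef A (ej j) * (f x * (x ord0 j * truncated_kern eps
      x))).
  apply/funext => x; rewrite /hilbert_density !cl_coefZ /cl_vec cl_coef_sum.
  rewrite !mulr_sumr; apply: eq_bigr => j _; rewrite cl_coefZ.
  rewrite truncated_kernE indicE; case: (leP (enorm x) eps) => h.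
    by rewrite memNset /= ?mulr0 ?mul0r// => /lt_geF; rewrite h.
  by rewrite mem_set//= exprS invfM; ring.
rewrite E integral_rV_sum; last by move=> j; exact: integrable_rVZl.
by apply: eq_bigr => j _; rewrite integral_rVZl.
Qed.

Lemma cvg_Pv_truncated A :
  cl_coef A (Pv_truncated (@hilbert_density R m) f eps) @[eps --> 0^'+] -->
    cl_coef A (odd_functional f).
Proof.
apply/cvg_at_rightP => u [u0 cu].
under eq_fun do rewrite (cl_coef_Pv_truncated A (u0 _)).
have -> : cl_coef A (odd_functional f) = \sum_j cl_coef A (ej j) * odd_pairing
  j f.
  by rewrite cl_coef_sum; apply: eq_bigr => j _; rewrite cl_coefZ mulrC.
apply: cvg_sumr => j; apply: cvgM; first exact: cvg_cst.
apply: (@cvg_test_odd_pairing _ (fun n => (u n ^+ m.+1)^-1)).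
- by move=> n; exact: measurable_truncated_kern.
- by move=> n x; rewrite !truncated_kernE enormN.
- by move=> n x; exact: truncated_kern_bounded.
- move=> n x x0; rewrite truncated_kernE; case: ifP => _.
    by rewrite normr0 invr_ge0 exprn_ge0// enorm_ge0.
  by rewrite ger0_norm// invr_ge0 exprn_ge0// enorm_ge0.
(* Once [u n] drops below |x| the truncation no longer affects the value at [x]. *)
- move=> x x0; apply: cvg_near_cst; near=> n.
  rewrite truncated_kernE ifF//; apply/negbTE; rewrite -ltNge.
  near: n; apply: (cvgr_lt _ cu).
  by rewrite lt_neqAle enorm_ge0 eq_sym enorm_eq0 x0.
Unshelve. all: by end_near. Qed.

Lemma Pv_hilbert_density : Pv (@hilbert_density R m) f = odd_functional f.
Proof.
apply: cl_coefP => A; rewrite [LHS]/cl_coef ffunE.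
by apply: cvg_lim => //; exact: cvg_Pv_truncated.
Qed.

Lemma hilbertE : hilbert f = - (2 / sphere_area R m.+1) *: odd_functional f.
Proof. by rewrite /hilbert Pv_hilbert_density. Qed.

End TestPairing.

(** The boundary value from above for [s = 1] and from below for [s = -1]. The scalar part changes
    sign with the side and the vector part does not, so the jump keeps only delta and the sum only
    the Hilbert kernel. *)
Definition cauchy_limit (s : R) : functional R m := fun f =>
  (s * (f 0 / 2))%:A - (sphere_area R m.+1)^-1 *: (e0bar * odd_functional f).

Lemma is_distribution_cauchy_limit (a : Cl) s :
  is_distribution (fun f => a * cauchy_limit s f).
Proof.
have -> : (fun f => a * cauchy_limit s f) = (fun f => f 0 *: ((s / 2) *: a) +
    \sum_j odd_pairing j f *: (- (sphere_area R m.+1)^-1 *: (a * (e0bar * ej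
      j)))).
  apply/funext => f; rewrite /cauchy_limit mulrBr -cl_scaleAr mulr1 scalerA.
  rewrite mulrCA; congr (_ + _).
  rewrite /odd_functional mulr_sumr scaler_sumr mulr_sumr -sumrN.
  apply: eq_bigr => j _; rewrite -!cl_scaleAr !scalerA mulrN scaleNr.
  by rewrite [_ * odd_pairing j f]mulrC.
apply: is_distributionD;
  first exact/is_distribution_scale/scalar_distribution_eval0.
by apply: is_distribution_sum => j;
  exact/is_distribution_scale/scalar_distribution_odd_pairing.
Qed.

(** Arranged to match [cl_coef_kernel_pairing] term by term; the factor [sphere_area / 2] is the
    limiting mass found in [cvg_poisson]. *)
Lemma cl_coef_cauchy_limit A (a : Cl) s f : cl_coef A (a * cauchy_limit s f) =
  (sphere_area R m.+1)^-1 * (cl_coef A a * (s * (f 0 * (sphere_area R m.+1 /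
    2))) -
    \sum_j cl_coef A (a * (e0bar * ej j)) * odd_pairing j f).
Proof.
rewrite /cauchy_limit mulrBr cl_coefB -!cl_scaleAr mulr1 !cl_coefZ mulrBr;
  congr (_ - _).
  by field; rewrite gt_eqF// sphere_area_gt0.
congr (_ * _); rewrite e0bar_odd_functional [in LHS]mulr_sumr cl_coef_sum.
by apply: eq_bigr => j _; rewrite -cl_scaleAr cl_coefZ mulrC.
Qed.

Lemma cl_coef_kernel_pairing f A (a : Cl) y : test_function f -> y != 0 ->
  cl_coef A (cl_integral setT (fun x => f x *: (a * cauchy_kernel (y, x)))) =
  (sphere_area R m.+1)^-1 *
    (cl_coef A a * (y * integral_rV setT (fun x => f x * kern y x)) -
     \sum_j cl_coef A (a * (e0bar * ej j)) *
       integral_rV setT (fun x => f x * (x ord0 j * kern y x))).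
Proof.
move=> tf y0; rewrite cl_coef_test_integral.
have kb (x : 'rV[R]_m) : `|kern y x| <= (`|y| ^+ m.+1)^-1.
  by rewrite ger0_norm ?kern_ge0// kern_le_norm.
have i0 := integrable_test_bounded tf (measurable_rV_kern y) kb.
have ij j := integrable_test_coord_bounded tf j (measurable_rV_kern y) kb.
have E : (fun x => f x * cl_coef A (a * cauchy_kernel (y, x))) = (fun x =>
    ((sphere_area R m.+1)^-1 * cl_coef A a * y) * (f x * kern y x) +
    \sum_j (- (sphere_area R m.+1)^-1 * cl_coef A (a * (e0bar * ej j))) *
      (f x * (x ord0 j * kern y x))).
  apply/funext => x; rewrite cl_coef_kernel cl_coef_conjE -/(kern y x) /=.
  rewrite mulrBr mulrBr mulrBr; congr (_ + _); first by ring.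
  rewrite !mulr_sumr -sumrN; apply: eq_bigr => j _; ring.
rewrite E integral_rVD; last 2 first.
- exact: integrable_rVZl.
- by apply: integrable_rV_sum => j; exact: integrable_rVZl.
rewrite integral_rVZl// integral_rV_sum; last by move=> j;
  exact: integrable_rVZl.
rewrite mulrBr !mulrA; congr (_ + _).
rewrite mulr_sumr -sumrN; apply: eq_bigr => j _.
by rewrite (integral_rVZl _ (ij j)) !mulNr mulrA.
Qed.

(** Both sides of the boundary at once: the height is written as a sign times a positive [v n], the
    radial factor [kern] is even in the height, and the sign survives only in front of the Poisson
    term. *)
Lemma cvg_kernel_pairing f A (a : Cl) s (y v : nat -> R) : test_function f ->
  s = 1 \/ s = -1 -> (forall n, 0 < v n) -> v n @[n --> \oo] --> 0 ->
  (forall n, y n = s * v n) ->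
  cl_coef A (cl_integral setT (fun x => f x *: (a * cauchy_kernel (y n, x))))
    @[n --> \oo] --> cl_coef A (a * cauchy_limit s f).
Proof.
move=> tf s1 v0 cv yE.
have v0' n : v n != 0 by rewrite gt_eqF.
have y0 n : y n != 0.
  by rewrite yE mulf_neq0//; case: s1 => ->; rewrite ?oppr_eq0 oner_eq0.
have ky n x : kern (y n) x = kern (v n) x :> R.
  by rewrite yE; case: s1 => ->; rewrite ?mul1r// mulN1r kernNl.
under eq_fun do rewrite (cl_coef_kernel_pairing A a tf (y0 _)).
have [M fM] := test_function_bounded tf.
rewrite cl_coef_cauchy_limit; apply: cvgM; first exact: cvg_cst.
apply: cvgB.
  apply: cvgM; first exact: cvg_cst.
  under eq_fun do rewrite yE -mulrA; apply: cvgM; first exact: cvg_cst.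
  have := cvg_poisson (test_function_continuous tf) fM v0 cv.
  apply: cvg_trans; apply: near_eq_cvg; apply: nearW => n; congr (_ * _).
  by congr integral_rV; apply/funext => x; rewrite -yE ky.
apply: cvg_sumr => j; apply: cvgM; first exact: cvg_cst.
apply: (@cvg_test_odd_pairing _ tf _ (fun n => (`|y n| ^+ m.+1)^-1)).
- by move=> n; exact: measurable_rV_kern.
- by move=> n x; exact: kernN.
- by move=> n x; rewrite ger0_norm ?kern_ge0// kern_le_norm.
- by move=> n x x0; rewrite ger0_norm ?kern_ge0// kern_le_enorm.
- move=> x x0; apply: cvg_kern0 => //.
  rewrite (_ : y = (fun n => s * v n)); last exact/funext.
  by rewrite -(mulr0 s); apply: cvgM; [exact: cvg_cst|exact: cv].
Qed.

Lemma dist_lim_right (a : Cl) :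
  dist_lim (fun p => a * cauchy_kernel p) 0^'+ (fun f => a * cauchy_limit 1 f).
Proof.
split; first exact: is_distribution_cauchy_limit.
move=> f tf A; apply/cvg_at_rightP => u [u0 cu].
have uE n : u n = 1 * u n by rewrite mul1r.
have H := @cvg_kernel_pairing f A a 1 u u tf (or_introl erefl) u0 cu uE.
exact: H.
Qed.

Lemma dist_lim_left (a : Cl) :
  dist_lim (fun p => a * cauchy_kernel p) 0^'- (fun f => a * cauchy_limit (-1)
    f).
Proof.
split; first exact: is_distribution_cauchy_limit.
move=> f tf A; apply/cvg_at_leftP => u [u0 cu].
have u0' n : 0 < - u n by rewrite oppr_gt0.
have cu' : - u n @[n --> \oo] --> 0 by rewrite -oppr0; exact: cvgN.
have uE n : u n = -1 * - u n by rewrite mulN1r opprK.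
have H := @cvg_kernel_pairing f A a (-1) u (fun n => - u n) tf (or_intror
  erefl) u0' cu' uE.
exact: H.
Qed.

Lemma cauchy_limitB f : cauchy_limit 1 f - cauchy_limit (-1) f = dirac_delta f.
Proof.
rewrite /cauchy_limit opprB addrA subrK mulN1r mul1r scaleNr opprK -scalerDl.
by rewrite -splitr.
Qed.

Lemma cauchy_limitD f : test_function f ->
  cauchy_limit 1 f + cauchy_limit (-1) f = e0bar * hilbert f.
Proof.
move=> tf; rewrite hilbertE// /cauchy_limit mulN1r mul1r scaleNr addrACA subrr
  add0r.
rewrite -mulr2n -[LHS]scaler_nat scalerN scalerA -cl_scaleAr scaleNr.
by [].
Qed.

Lemma is_distribution_hilbert : is_distribution (@hilbert R m).
Proof.
apply: (@is_distribution_eq _ (fun f => \sum_j odd_pairing j f *: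
    (- (2 / sphere_area R m.+1) *: ej j))).
  move=> f tf; rewrite hilbertE// /odd_functional scaler_sumr.
  by apply: eq_bigr => j _; rewrite !scalerA mulrC.
by apply: is_distribution_sum => j;
  exact/is_distribution_scale/scalar_distribution_odd_pairing.
Qed.

Lemma is_distribution_dirac : is_distribution (@dirac_delta R m).
Proof. exact: (is_distribution_scale 1 scalar_distribution_eval0). Qed.

End Distributions.

(** * Representation of delta and H by couples of monogenic functions *)

Theorem mainTheorem1 (R : realType) (m : nat) (hm : (0 < m)%N) :
  [/\ Pv_exists (@hilbert_density R m),
      exists cp cm : functional R m,
        [/\ dist_lim (@cauchy_kernel R m) 0^'+ cp,
            dist_lim (@cauchy_kernel R m) 0^'- cm,
            eq_distribution (fun f => cp f - cm f) (@dirac_delta R m) &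
            eq_distribution (fun f => cp f + cm f)
                            (fun f => e0bar R m * hilbert f)],
      represented_by (@left_monogenic R m) (@dirac_delta R m)
                     (@cauchy_kernel R m) (@cauchy_kernel R m),
      represented_by (@right_monogenic R m) (@hilbert R m)
                     (fun x => e0 R m * cauchy_kernel x)
                     (fun x => e0bar R m * cauchy_kernel x) &
      (forall x : R * 'rV[R]_m, upper_half x ->
         e0 R m * cauchy_kernel x =
           (sphere_area R m.+1)^-1 *: ((pnorm x ^+ m.+1)^-1 *:
              (x.1 *: e0 R m - cl_vec x.2))) /\
      (forall x : R * 'rV[R]_m, lower_half x ->
         e0bar R m * cauchy_kernel x =
           (sphere_area R m.+1)^-1 *: ((pnorm x ^+ m.+1)^-1 *:
              (x.1 *: e0bar R m + cl_vec x.2)))].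
Proof.
have lim1 (l : set_system R) (T : functional R m) :
    dist_lim (fun p => 1 * cauchy_kernel p) l (fun f => 1 * T f) ->
    dist_lim (@cauchy_kernel R m) l T.
  rewrite (_ : (fun p => 1 * cauchy_kernel p) = @cauchy_kernel R m); last first.
    by apply/funext => p; rewrite mul1r.
  by rewrite (_ : (fun f => 1 * T f) = T)//; apply/funext => f; rewrite mul1r.
have limr := lim1 _ _ (@dist_lim_right R m 1).
have liml := lim1 _ _ (@dist_lim_left R m 1).
split.
- by move=> f tf A; apply/cvg_ex; eexists; exact: cvg_Pv_truncated.
- exists (cauchy_limit 1), (cauchy_limit (-1)); split=> // f tf.
    exact: cauchy_limitB.
  exact: cauchy_limitD.
- split.
  + exact: is_distribution_dirac.
  + exact/left_monogenic_kernel/pnorm_upper_half.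
  + exact/left_monogenic_kernel/pnorm_lower_half.
  exists (cauchy_limit 1), (cauchy_limit (-1)); split=> // f tf.
  by rewrite cauchy_limitB.
- split.
  + exact: is_distribution_hilbert.
  + exact/right_monogenic_kernel/pnorm_upper_half.
  + exact/right_monogenic_kernel/pnorm_lower_half.
  (* Since [e0bar] is [- e0], the difference of the two boundary values is [e0] times the sum c^+ +
     c^-, that is [e0 * e0bar] times H, and [e0 * e0bar = 1]. *)
  exists (fun f => e0 R m * cauchy_limit 1 f), (fun f => e0bar R m *
    cauchy_limit (-1) f).
  split; [exact: dist_lim_right|exact: dist_lim_left|].
  move=> f tf; rewrite /e0bar mulNr opprK -mulrDr cauchy_limitD//.
  by rewrite mulrA e0_e0bar mul1r.
- split=> x _; rewrite cauchy_kernelE -!cl_scaleAr; do 2 congr (_ *: _);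
    rewrite /cl_conj mulrBr -cl_scaleAr mulr1 mulrA.
    by rewrite e0_e0bar mul1r.
  by rewrite [e0bar _ _ * e0bar _ _]mulrNN e0_sqr mulN1r opprK.
Qed.
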